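(* Let $m\in\{2,3\}$ and let $\mathcal Z$ be a given desired infinitesimally and minimally rigid shape. Consider the second-order system $\dot p=v$, $\dot v=u$ with control law $$u=-c_1v-c_2\overline BD_ze+\overline A(\mu,\tilde\mu)z,\qquad A(\mu,\tilde\mu)=c_1A_v(\mu,\tilde\mu)+A_a(\mu,\tilde\mu),$$ where $z=\overline B^Tp$, $e_k=\|z_k\|^2-d_k^2$, and $(\mu,\tilde\mu)$ are motion parameters designed for the shape $\mathcal Z$ (as defined in the context). Let $e_v=v-\overline A_v(\mu,\tilde\mu)z$. Then there exist constants $\rho,\rho_\mu,\epsilon,c_1,c_2>0$ such that if $$\begin{bmatrix}\mu\\\tilde\mu\end{bmatrix}\in\mathcal M=\Big\{\mu,\tilde\mu:\Big\|\begin{bmatrix}\mu\\\tilde\mu\end{bmatrix}\Big\|\le\rho_\mu\Big\},$$ then the origin $e_v=\mathbf 0$, $e=\mathbf 0$ of the error dynamical system, corresponding to $z^*(t)\in\mathcal Z$, is exponentially stable in the compact set $$\mathcal Q=\Big\{e,e_v:\tfrac{\epsilon c_1+c_2}{4}\|e\|^2+\tfrac12\|e_v\|^2\le\rho\Big\}.$$ In particular, the steady-state shape is the same as the desired one ($z(t)\to z^*(t)\in\mathcal Z$) and the steady-state collective motion of the formation corresponds to $v^*(t)=\overline A_vz^*(t)$.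
   Context: Notation. $n\ge2$ agents have positions $p_i\in\mathbb R^m$ and velocities $v_i\in\mathbb R^m$; $p,v,u\in\mathbb R^{mn}$ are stacked vectors. For a matrix $A$, $\overline A=A\otimes I_m$ (Kronecker product). For a stacked vector $x=[x_1^T\dots x_k^T]^T$ with blocks $x_i\in\mathbb R^m$, $D_x=\operatorname{diag}\{x_i\}$ is the $km\times k$ block-diagonal matrix with the column blocks $x_i$. Graph. The sensing topology is an undirected graph $\mathbb G=(\mathcal V,\mathcal E)$, $\mathcal V=\{1,\dots,n\}$, whose edges are ordered and written $\mathcal E_k=(\mathcal E_k^{\rm tail},\mathcal E_k^{\rm head})$. The incidence matrix $B\in\mathbb R^{|\mathcal V|\times|\mathcal E|}$ has $b_{ik}=1$ if $i=\mathcal E_k^{\rm tail}$, $b_{ik}=-1$ if $i=\mathcal E_k^{\rm head}$, and $0$ otherwise. $z_k=p_i-p_j$ for $\mathcal E_k=(i,j)$. Rigidity. The rigidity matrix is $R(z)=D_z^T\overline B^T$. A framework $(\mathbb G,p)$ is infinitesimally and minimally rigid if $\operatorname{rank}R(z)=|\mathcal E|=2n-3$ (for $m=2$) or $\operatorname{rank}R(z)=|\mathcal E|=3n-6$ (for $m=3$). Given the desired relative positions ${}^bz^*$ of such a framework, expressed in a body frame $O_b$ attached to the centroid of the desired shape, $\mathcal Z=\{(I_{|\mathcal E|}\otimes\mathcal R)\,{}^bz^*:\mathcal R\in SO(m)\}$ and $d_k=\|{}^bz^*_k\|$. The error dynamics are considered for configurations near $\mathcal Z$, so that $e=\mathbf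 0$ corresponds to $z\in\mathcal Z$. Motion parameters. For $\mu,\tilde\mu\in\mathbb R^{|\mathcal E|}$, $A_v(\mu,\tilde\mu)\in\mathbb R^{|\mathcal V|\times|\mathcal E|}$ has entries $a_{ik}=\mu_k$ if $i=\mathcal E_k^{\rm tail}$, $a_{ik}=\tilde\mu_k$ if $i=\mathcal E_k^{\rm head}$, and $0$ otherwise. Let $T(z)$ be the matrix defined by $\overline A_v(\mu,\tilde\mu)z=T(z)\begin{bmatrix}\mu\\\tilde\mu\end{bmatrix}$ for all $\mu,\tilde\mu$. With $P_{\mathcal X}$ the orthogonal projection onto a subspace $\mathcal X$, set $$\hat{\mathcal U}=P_{\operatorname{Ker}\{T({}^bz^* )\}^\perp}\big\{\operatorname{Ker}\{\overline B^TT({}^bz^* )\}\big\},\qquad \hat{\mathcal W}=P_{\hat{\mathcal U}^\perp}\big\{\operatorname{Ker}\{D_{{}^bz^*}^T\overline B^TT({}^bz^* )\}\big\}.$$ Motion parameters designed for the shape $\mathcal Z$ are pairs $\mu=\mu_v+\mu_\omega$, $\tilde\mu=\tilde\mu_v+\tilde\mu_\omega$ with $\begin{bmatrix}\mu_v\\\tilde\mu_v\end{bmatrix}\in\hat{\mathcal U}$ (translational part) and $\begin{bmatrix}\mu_\omega\\\tilde\mu_\omega\end{bmatrix}\in\hat{\mathcal W}$ (rotational part). The matrix $A_a$ is defined by $\overline A_a=\overline A_v\overline B^T\overline A_v$, i.e. $A_a=A_vB^TA_v$. *)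

(* Defs.v *)
From HB Require Import structures.
From mathcomp Require Import all_boot all_order all_algebra.
From mathcomp Require Import all_classical all_reals all_analysis.
From mathcomp Require Export mxtens.

Set Implicit Arguments.
Unset Strict Implicit.
Unset Printing Implicit Defensive.

Import Order.TTheory GRing.Theory Num.Theory.
Import numFieldNormedType.Exports.

Local Open Scope classical_set_scope.
Local Open Scope ring_scope.

(* 'M[R]_(p, q) carries the sup norm in the library, hence these. *)
Definition sqnorm (R : realType) (k : nat) (x : 'cV[R]_k) : R :=
  \sum_i x i 0 ^+ 2.

Definition enorm (R : realType) (k : nat) (x : 'cV[R]_k) : R :=
  Num.sqrt (sqnorm x).

Section Subspaces.
Variable R : realType.

(* Kernels act on column vectors; mathcomp's kermx is the row kernel. *)
Definition Ker (p q : nat) (A : 'M[R]_(p, q)) : set 'cV[R]_q :=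
  [set x | A *m x = 0].

Definition orthocompl (q : nat) (X : set 'cV[R]_q) : set 'cV[R]_q :=
  [set y | forall x, X x -> x^T *m y = 0].

(* [orthoproj X x y] : y is the orthogonal projection P_X x of x onto the
   subspace X. *)
Definition orthoproj (q : nat) (X : set 'cV[R]_q) (x y : 'cV[R]_q) : Prop :=
  X y /\ orthocompl X (x - y).

Definition orthoproj_image (q : nat) (X S : set 'cV[R]_q) : set 'cV[R]_q :=
  [set y | exists2 x, S x & orthoproj X x y].

Definition SO (m : nat) : set 'M[R]_m :=
  [set Q | Q^T *m Q = 1%:M /\ \det Q = 1].

End Subspaces.

Arguments SO {R} m.

(* A stacked vector with k blocks in R^m has type 'cV_(k * m); coordinate i of
   block j sits at row [mxtens_index (j, i)], which is the layout of *t. *)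
Section Stacked.
Variables (R : realType) (m : nat).

Definition block (k : nat) (x : 'cV[R]_(k * m)) (j : 'I_k) : 'cV[R]_m :=
  \col_i x (mxtens_index (j, i)) 0.

Definition Dmx (k : nat) (x : 'cV[R]_(k * m)) : 'M[R]_(k * m, k) :=
  \matrix_(r, j) (if (mxtens_unindex r).1 == j then x r 0 else 0).

Definition bar (p q : nat) (A : 'M[R]_(p, q)) : 'M[R]_(p * m, q * m) :=
  A *t (1%:M : 'M[R]_m).

End Stacked.

Arguments bar {R} m {p q} A.

(* Undirected simple graph on 'I_n with E edges, numbered and each given an
   (arbitrary) orientation. *)
Record graph (n E : nat) := Graph {
  tail : 'I_E -> 'I_n;
  head : 'I_E -> 'I_n;
  tail_neq_head : forall k, tail k != head k;
  edge_inj : forall k l,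
    [set tail k; head k]%SET = [set tail l; head l]%SET -> k = l
}.

Section Formation.
Variables (R : realType) (n E : nat) (m : nat) (G : graph n E).

Definition incidence : 'M[R]_(n, E) :=
  \matrix_(i, k) (if i == tail G k then 1
                  else if i == head G k then -1 else 0).

Definition Av (mu mut : 'cV[R]_E) : 'M[R]_(n, E) :=
  \matrix_(i, k) (if i == tail G k then mu k 0
                  else if i == head G k then mut k 0 else 0).

Definition Aa (mu mut : 'cV[R]_E) : 'M[R]_(n, E) :=
  Av mu mut *m incidence^T *m Av mu mut.

Definition relpos (p : 'cV[R]_(n * m)) : 'cV[R]_(E * m) :=
  (bar m incidence)^T *m p.

Definition rigidity (z : 'cV[R]_(E * m)) : 'M[R]_(E, n * m) :=
  (Dmx z)^T *m (bar m incidence)^T.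

Definition inf_min_rigid (p : 'cV[R]_(n * m)) : Prop :=
  [/\ m = 2%N, \rank (rigidity (relpos p)) = E & E = (2 * n - 3)%N] \/
  [/\ m = 3%N, \rank (rigidity (relpos p)) = E & E = (3 * n - 6)%N].

Definition tail_mx : 'M[R]_(n, E) := \matrix_(i, k) (i == tail G k)%:R.
Definition head_mx : 'M[R]_(n, E) := \matrix_(i, k) (i == head G k)%:R.

(* The defining property of T(z) is lemma [TmxE]; it determines T(z). *)
Definition Tmx (z : 'cV[R]_(E * m)) : 'M[R]_(n * m, E + E) :=
  row_mx (bar m tail_mx *m Dmx z) (bar m head_mx *m Dmx z).

Lemma TmxE (z : 'cV[R]_(E * m)) (mu mut : 'cV[R]_E) :
  bar m (Av mu mut) *m z = Tmx z *m col_mx mu mut.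
Proof.
have Dmu (w : 'cV[R]_E) : Dmx z *m w = bar m (diag_mx w^T) *m z.
  apply/colP => r; rewrite !mxE; case: (mxtens_indexP r) => j i.
  rewrite (bigD1 j) //= !mxE mxtens_indexK eqxx big1 ?addr0; last first.
    by move=> k kj; rewrite !mxE mxtens_indexK eq_sym (negbTE kj) mul0r.
  rewrite (bigD1 (mxtens_index (j, i))) //= tensmxE !mxE !eqxx mulr1n mulr1.
  rewrite big1 ?addr0 1?mulrC //.
  move=> s; case: (mxtens_indexP s) => k l /= kl.
  rewrite tensmxE !mxE; case: (eqVneq j k) => [jk|_]; last by rewrite !mul0r.
  case: (eqVneq i l) => [il|_]; last by rewrite mulr0 mul0r.
  by rewrite jk il eqxx in kl.
rewrite /Tmx mul_row_col -!mulmxA !Dmu !mulmxA -mulmxDl; congr (_ *m z).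
rewrite /bar !tensmx_mul !mul1mx; apply/matrixP => r s.
case: (mxtens_indexP r) => i a; case: (mxtens_indexP s) => k b.
rewrite [in RHS]mxE !tensmxE -mulrDl; congr (_ * _).
rewrite !mul_mx_diag !mxE.
case: (eqVneq i (tail G k)) => [->|_].
  by rewrite (negbTE (tail_neq_head G k)) mul1r mul0r addr0.
by case: eqVneq => _; rewrite mul0r add0r ?mul1r ?mul0r.
Qed.

Variable zb : 'cV[R]_(E * m).

Definition shape : set 'cV[R]_(E * m) :=
  [set z | exists2 Q, SO m Q & z = ((1%:M : 'M[R]_E) *t Q) *m zb].

Definition near_shape (delta : R) (z : 'cV[R]_(E * m)) : Prop :=
  exists2 zs, shape zs & enorm (z - zs) <= delta.

Definition err (z : 'cV[R]_(E * m)) : 'cV[R]_E :=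
  \col_k (enorm (block z k) ^+ 2 - enorm (block zb k) ^+ 2).

(* Radii of neighbourhoods of the shape in which e = 0 corresponds to the shape.
   Farther away e = 0 also holds at other realizations of the same distances,
   e.g. the reflected shape. *)
Definition isolating (delta : R) : Prop :=
  forall p, near_shape delta (relpos p) ->
    err (relpos p) = 0 -> shape (relpos p).

Definition Uhat : set 'cV[R]_(E + E) :=
  orthoproj_image (orthocompl (Ker (Tmx zb)))
    (Ker ((bar m incidence)^T *m Tmx zb)).

Definition What : set 'cV[R]_(E + E) :=
  orthoproj_image (orthocompl Uhat)
    (Ker ((Dmx zb)^T *m (bar m incidence)^T *m Tmx zb)).

Definition designed (mu mut : 'cV[R]_E) : Prop :=
  exists muv mutv muw mutw : 'cV[R]_E,
    [/\ Uhat (col_mx muv mutv), What (col_mx muw mutw),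
        mu = muv + muw & mut = mutv + mutw].

Variables (c1 c2 : R) (mu mut : 'cV[R]_E).

Definition control (p v : 'cV[R]_(n * m)) : 'cV[R]_(n * m) :=
  let z := relpos p in
  - c1 *: v - c2 *: (bar m incidence *m Dmx z *m err z)
  + bar m (c1 *: Av mu mut + Aa mu mut) *m z.

Definition verr (p v : 'cV[R]_(n * m)) : 'cV[R]_(n * m) :=
  v - bar m (Av mu mut) *m relpos p.

(* Solutions of the closed loop on the interval [0, T[, with T finite or +oo;
   the values outside of the interval are irrelevant. *)
Definition solution (T : \bar R) (p v : R -> 'cV[R]_(n * m)) : Prop :=
  [/\ {within [set t : R | 0 <= t /\ (t%:E < T)%E], continuous p},
      {within [set t : R | 0 <= t /\ (t%:E < T)%E], continuous v} &
      forall t : R, 0 < t -> (t%:E < T)%E ->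
        is_derive t 1 p (v t) /\ is_derive t 1 v (control (p t) (v t))].

Definition Qset (rho eps : R) (e : 'cV[R]_E) (ev : 'cV[R]_(n * m)) : Prop :=
  (eps * c1 + c2) / 4 * enorm e ^+ 2 + 1 / 2 * enorm ev ^+ 2 <= rho.

(* The origin of the (e, e_v)-dynamics is exponentially stable in Q, for
   configurations within delta of the shape: the bound is uniform over all
   initial conditions and all intervals of existence. *)
Definition exp_stable_in (delta rho eps : R) : Prop :=
  exists K lambda : R, [/\ 0 < K, 0 < lambda &
    forall (T : \bar R) (p v : R -> 'cV[R]_(n * m)),
      (0 < T)%E -> solution T p v ->
      near_shape delta (relpos (p 0)) ->
      Qset rho eps (err (relpos (p 0))) (verr (p 0) (v 0)) ->
      forall t : R, 0 <= t -> (t%:E < T)%E ->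
        near_shape delta (relpos (p t)) /\
        enorm (col_mx (err (relpos (p t))) (verr (p t) (v t)))
          <= K * enorm (col_mx (err (relpos (p 0))) (verr (p 0) (v 0)))
             * expR (- lambda * t)].

Definition steady_state (delta rho eps : R) : Prop :=
  forall p v : R -> 'cV[R]_(n * m),
    solution +oo%E p v ->
    near_shape delta (relpos (p 0)) ->
    Qset rho eps (err (relpos (p 0))) (verr (p 0) (v 0)) ->
    exists zs : R -> 'cV[R]_(E * m),
      [/\ forall t, 0 <= t -> shape (zs t),
          enorm (relpos (p t) - zs t) @[t --> +oo] --> (0 : R) &
          enorm (v t - bar m (Av mu mut) *m zs t) @[t --> +oo] --> (0 : R)].

End Formation.

(* Main.v *)
Require Import Defs.
From mathcomp Require Import all_boot all_order all_algebra.
From mathcomp Require Import all_classical all_reals all_analysis.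
From mathcomp Require Import ring lra zify.

Import Order.TTheory GRing.Theory Num.Theory.
Import numFieldNormedType.Exports.

Local Open Scope ring_scope.

(** The statement combines a rigidity argument, which makes [e = 0] equivalent
    to being on the shape near the shape, with a Lyapunov argument for the
    closed loop. Gains [c1 = c2 = 1] suffice. All norms of matrices are
    Frobenius norms [fnorm], for the inner product [ip A B = tr (A^T B)].

    Rigidity. Given [z = relpos p], rotate [zb] to the point [Q zb] of the shape
    closest to [z] ([best_rotation]; SO(m) is compact). Optimality of [Q] says
    that the cross-Gram matrix [\sum_k z_k (Q zb)_k^T] is symmetric, that is, the
    displacement [w = Q^T z - zb] is orthogonal to all [S zb] with [S] skew. By a
    dimension count an infinitesimal motion of the framework is a translation
    plus such a [S] ([rigid_motion]), so [D_zb^T] is injective on the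
    displacements in question, with a linear bound ([rigid_coercive]). As
    [e = 2 D_zb^T w + O(|w|^2)], the distance to the shape is at most a constant
    times [|e|] near the shape ([local_error_bound]). This proves that isolating
    radii exist without the implicit function theorem. For an arbitrary isolating
    radius [delta], compactness shows that a small [e] within [delta] of the shape
    forces [z] to be close to the shape ([confinement]).

    Lyapunov function. With [g = D_z^T B^T ev] take
    [V = (eps + 1) / 4 * |e|^2 + 1 / 2 * |ev|^2 + eps * <e, g>]. The tracking error
    obeys [ev' = - ev - B D_z e - A_v B^T ev], and in [V'] the terms [<e, g>]
    cancel, while the mixed term contributes [- eps |B D_z e|^2], which is
    [<= - const * |e|^2] by rigidity ([edge_coercive]). What remains is small: for
    designed motion parameters the drift [D_z^T B^T A_v z] vanishes on the shape,
    hence is [O(|mu| |e|)], and [A_v] itself is [O(|mu|)]. So for [eps], and then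
    [|mu|], small, [V' <= - const * (|e|^2 + |ev|^2)] near the shape
    ([lyap_decreases]).

    Conclusion. A trajectory that starts with a small error stays in the
    neighbourhood where the estimates hold, by induction along time: the decay of
    [V] keeps [e] small, and [confinement] turns this into closeness to the shape
    ([trajectory_near]). Points of the shape within a constant times [|e|] of
    [z (t)] make up the limit motion. *)

Set Implicit Arguments.
Unset Strict Implicit.
Unset Printing Implicit Defensive.

(** * The Frobenius norm *)

Section Frobenius.
Variable R : realType.

Definition ip (p q : nat) (A B : 'M[R]_(p, q)) : R := \tr (A^T *m B).

Definition fnorm (p q : nat) (A : 'M[R]_(p, q)) : R := Num.sqrt (ip A A).

Lemma ipE p q (A B : 'M[R]_(p, q)) : ip A B = \sum_i \sum_j A i j * B i j.
Proof.
rewrite /ip /mxtrace exchange_big /=; apply: eq_bigr => j _; rewrite !mxE.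
by apply: eq_bigr => i _; rewrite !mxE.
Qed.

Lemma ip_colE k (x y : 'cV[R]_k) : ip x y = \sum_i x i 0 * y i 0.
Proof. by rewrite ipE; apply: eq_bigr => i _; rewrite big_ord1. Qed.

Lemma ipC p q (A B : 'M[R]_(p, q)) : ip A B = ip B A.
Proof. by rewrite /ip -mxtrace_tr trmx_mul trmxK. Qed.

Lemma ipDl p q (A B C : 'M[R]_(p, q)) : ip (A + B) C = ip A C + ip B C.
Proof. by rewrite /ip linearD mulmxDl linearD. Qed.

Lemma ipDr p q (A B C : 'M[R]_(p, q)) : ip A (B + C) = ip A B + ip A C.
Proof. by rewrite /ip mulmxDr linearD. Qed.

Lemma ipZl p q a (A B : 'M[R]_(p, q)) : ip (a *: A) B = a * ip A B.
Proof. by rewrite /ip linearZ /= -scalemxAl linearZ. Qed.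

Lemma ipZr p q a (A B : 'M[R]_(p, q)) : ip A (a *: B) = a * ip A B.
Proof. by rewrite /ip -scalemxAr linearZ. Qed.

Lemma ipNl p q (A B : 'M[R]_(p, q)) : ip (- A) B = - ip A B.
Proof. by rewrite -scaleN1r ipZl mulN1r. Qed.

Lemma ipNr p q (A B : 'M[R]_(p, q)) : ip A (- B) = - ip A B.
Proof. by rewrite -scaleN1r ipZr mulN1r. Qed.

Lemma ipBl p q (A B C : 'M[R]_(p, q)) : ip (A - B) C = ip A C - ip B C.
Proof. by rewrite ipDl ipNl. Qed.

Lemma ipBr p q (A B C : 'M[R]_(p, q)) : ip A (B - C) = ip A B - ip A C.
Proof. by rewrite ipDr ipNr. Qed.

Lemma ip_mull p q r (M : 'M[R]_(p, q)) (A : 'M[R]_(q, r)) B :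
  ip (M *m A) B = ip A (M^T *m B).
Proof. by rewrite /ip trmx_mul mulmxA. Qed.

Lemma ip_mulr p q r (M : 'M[R]_(p, q)) (A : 'M[R]_(q, r)) B :
  ip B (M *m A) = ip (M^T *m B) A.
Proof. by rewrite ipC ip_mull ipC. Qed.

Lemma ip_ge0 p q (A : 'M[R]_(p, q)) : 0 <= ip A A.
Proof.
by rewrite ipE; apply: sumr_ge0 => i _; apply: sumr_ge0 => j _; exact: sqr_ge0.
Qed.

Lemma ip_eq0 p q (A : 'M[R]_(p, q)) : ip A A = 0 -> A = 0.
Proof.
rewrite ipE => /eqP A0; apply/matrixP => i j; rewrite mxE.
move: A0; rewrite psumr_eq0; last by move=> ? _; apply: sumr_ge0 => ? _; exact: sqr_ge0.
move=> /allP/(_ i (mem_index_enum _)) /=.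
rewrite psumr_eq0; last by move=> ? _; exact: sqr_ge0.
move=> /allP/(_ j (mem_index_enum _)) /=.
by rewrite mulf_eq0 orbb => /eqP.
Qed.

Lemma fnorm_ge0 p q (A : 'M[R]_(p, q)) : 0 <= fnorm A.
Proof. exact: sqrtr_ge0. Qed.

Lemma sqr_fnorm p q (A : 'M[R]_(p, q)) : fnorm A ^+ 2 = ip A A.
Proof. by rewrite sqr_sqrtr ?ip_ge0. Qed.

Lemma fnorm_eq0 p q (A : 'M[R]_(p, q)) : fnorm A = 0 -> A = 0.
Proof. by move=> A0; apply: ip_eq0; rewrite -sqr_fnorm A0 expr0n. Qed.

Lemma fnorm0 p q : fnorm (0 : 'M[R]_(p, q)) = 0.
Proof. by rewrite /fnorm /ip mulmx0 mxtrace0 sqrtr0. Qed.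

Lemma ler_ip p q (A B : 'M[R]_(p, q)) : ip A B <= fnorm A * fnorm B.
Proof.
have [/fnorm_eq0 ->|A0] := eqVneq (fnorm A) 0.
  by rewrite fnorm0 mul0r /ip trmx0 mul0mx mxtrace0.
have [/fnorm_eq0 ->|B0] := eqVneq (fnorm B) 0.
  by rewrite fnorm0 mulr0 /ip mulmx0 mxtrace0.
have Ap : 0 < fnorm A by rewrite lt_neqAle eq_sym A0 fnorm_ge0.
have Bp : 0 < fnorm B by rewrite lt_neqAle eq_sym B0 fnorm_ge0.
have := ip_ge0 (fnorm B *: A - fnorm A *: B).
rewrite ipBl !ipBr !ipZl !ipZr (ipC B A) -!sqr_fnorm => h.
have AB : 0 < fnorm A * fnorm B by exact: mulr_gt0.
rewrite -(ler_pM2l AB); nra.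
Qed.

Lemma ler_norm_ip p q (A B : 'M[R]_(p, q)) : `|ip A B| <= fnorm A * fnorm B.
Proof.
rewrite ler_norml ler_ip andbT lerNl -ipNl.
by apply: le_trans (ler_ip _ _) _; rewrite /fnorm ipNl ipNr opprK.
Qed.

Lemma fnormD p q (A B : 'M[R]_(p, q)) : fnorm (A + B) <= fnorm A + fnorm B.
Proof.
rewrite -(@ler_pXn2r _ 2) ?nnegrE ?addr_ge0 ?fnorm_ge0 //.
rewrite sqr_fnorm ipDl !ipDr (ipC B A) -!sqr_fnorm.
by have := ler_ip A B; lra.
Qed.

Lemma fnormZ p q a (A : 'M[R]_(p, q)) : fnorm (a *: A) = `|a| * fnorm A.
Proof.
by rewrite /fnorm ipZl ipZr mulrA -expr2 sqrtrM ?sqr_ge0 // sqrtr_sqr.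
Qed.

Lemma fnormN p q (A : 'M[R]_(p, q)) : fnorm (- A) = fnorm A.
Proof. by rewrite -scaleN1r fnormZ normrN1 mul1r. Qed.

Lemma fnormBC p q (A B : 'M[R]_(p, q)) : fnorm (A - B) = fnorm (B - A).
Proof. by rewrite -fnormN opprB. Qed.

Lemma fnorm_tr p q (A : 'M[R]_(p, q)) : fnorm A^T = fnorm A.
Proof. by rewrite /fnorm /ip trmxK mxtrace_mulC. Qed.

Lemma fnormM p q r (A : 'M[R]_(p, q)) (B : 'M[R]_(q, r)) :
  fnorm (A *m B) <= fnorm A * fnorm B.
Proof.
rewrite -(@ler_pXn2r _ 2) ?nnegrE ?mulr_ge0 ?fnorm_ge0 //.
rewrite exprMn !sqr_fnorm (ipE (A *m B)) (ipE A) mulr_suml.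
apply: ler_sum => i _; rewrite ipE exchange_big mulr_sumr /=.
apply: ler_sum => j _.
have -> : (A *m B) i j = ip (row i A)^T (col j B).
  by rewrite ip_colE mxE; apply: eq_bigr => k _; rewrite !mxE.
have -> : \sum_k A i k * A i k = ip (row i A)^T (row i A)^T.
  by rewrite ip_colE; apply: eq_bigr => k _; rewrite !mxE.
have -> : \sum_k B k j * B k j = ip (col j B) (col j B).
  by rewrite ip_colE; apply: eq_bigr => k _; rewrite !mxE.
rewrite -!sqr_fnorm -exprMn -expr2 -[X in X <= _]real_normK ?num_real // ler_pXn2r ?nnegrE //.
  exact: ler_norm_ip.
by rewrite mulr_ge0 ?fnorm_ge0.
Qed.

Lemma fnorm_tens p q r s (A : 'M[R]_(p, q)) (B : 'M[R]_(r, s)) :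
  fnorm (A *t B) = fnorm A * fnorm B.
Proof.
rewrite /fnorm -sqrtrM ?ip_ge0 //; congr Num.sqrt; rewrite !ipE.
rewrite [RHS]mulr_sum; apply: eq_bigr => i _; rewrite [RHS]mulr_sum.
by apply: eq_bigr => j _; rewrite !mxE mulrACA.
Qed.

Lemma fnorm_col_mx p q r (A : 'M[R]_(p, r)) (B : 'M[R]_(q, r)) :
  fnorm (col_mx A B) ^+ 2 = fnorm A ^+ 2 + fnorm B ^+ 2.
Proof.
by rewrite !sqr_fnorm /ip tr_col_mx mul_row_col linearD.
Qed.

Lemma sqnormE k (x : 'cV[R]_k) : sqnorm x = ip x x.
Proof. by rewrite ip_colE. Qed.

Lemma enormE k (x : 'cV[R]_k) : enorm x = fnorm x.
Proof. by rewrite /enorm sqnormE. Qed.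

Lemma fnorm_orth p q r (U : 'M[R]_(p, q)) (A : 'M[R]_(q, r)) :
  U^T *m U = 1%:M -> fnorm (U *m A) = fnorm A.
Proof. by move=> UU; rewrite /fnorm ip_mull mulmxA UU mul1mx. Qed.

Lemma fnorm_entry p q (A : 'M[R]_(p, q)) i j : `|A i j| <= fnorm A.
Proof.
rewrite -sqrtr_sqr ler_wsqrtr // ipE (bigD1 i) //= (bigD1 j) //= -addrA lerDl.
by rewrite addr_ge0 // sumr_ge0 // => *; rewrite ?sumr_ge0 // => *; exact: sqr_ge0.
Qed.

(** A linear system that only sees [B] through [A] factors through [A]; the
    norm of the factor gives the bound. *)
Lemma ker_sub_bound p q r (A : 'M[R]_(p, q)) (B : 'M[R]_(r, q)) :
  (forall x : 'cV_q, A *m x = 0 -> B *m x = 0) ->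
  exists2 C : R, 0 < C & forall x : 'cV_q, fnorm (B *m x) <= C * fnorm (A *m x).
Proof.
move=> AB.
have /submxP[X BE] : (B <= A)%MS.
  rewrite submxE; apply/eqP/matrixP => i j; rewrite [RHS]mxE.
  have /AB : A *m col j (cokermx A) = 0.
    by rewrite colE mulmxA mulmx_coker mul0mx.
  by rewrite colE mulmxA -colE => /colP/(_ i); rewrite !mxE.
exists (1 + fnorm X); first by have := fnorm_ge0 X; lra.
move=> x; rewrite BE -mulmxA; apply: le_trans (fnormM _ _) _.
by rewrite ler_wpM2r ?fnorm_ge0 // lerDr.
Qed.

End Frobenius.

(** * Stacked vectors *)

Section StackedAlgebra.
Variables (R : realType) (m : nat).

Lemma big_mxtens k (F : 'I_(k * m) -> R) :
  \sum_r F r = \sum_j \sum_i F (mxtens_index (j, i)).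
Proof.
rewrite pair_bigA (reindex (@mxtens_index k m)) /=; last first.
  exists (@mxtens_unindex k m) => x _; [exact: mxtens_indexK|exact: mxtens_unindexK].
by apply: eq_bigr => -[].
Qed.

(** The blocks as rows: [bar A] then acts by left multiplication with [A] and a
    rotation by right multiplication. *)
Definition unstack k (z : 'cV[R]_(k * m)) : 'M[R]_(k, m) :=
  \matrix_(j, i) z (mxtens_index (j, i)) 0.

Definition rotmx k (Q : 'M[R]_m) : 'M[R]_(k * m) := (1%:M : 'M[R]_k) *t Q.

Lemma unstack_inj k : injective (@unstack k).
Proof.
move=> z w /matrixP zw; apply/colP => r; case: (mxtens_indexP r) => j i.
by have := zw j i; rewrite !mxE.
Qed.

Lemma unstackB k (z w : 'cV[R]_(k * m)) : unstack (z - w) = unstack z - unstack w.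
Proof. by apply/matrixP => j i; rewrite !mxE. Qed.

Lemma unstack0 k : unstack (0 : 'cV[R]_(k * m)) = 0.
Proof. by apply/matrixP => j i; rewrite !mxE. Qed.

Lemma unstack_bar p q (A : 'M[R]_(p, q)) (z : 'cV[R]_(q * m)) :
  unstack (bar m A *m z) = A *m unstack z.
Proof.
apply/matrixP => j i; rewrite !mxE big_mxtens; apply: eq_bigr => k _.
rewrite (bigD1 i) //= !tensmxE mxE eqxx mulr1 big1 ?addr0 ?mxE // => l li.
by rewrite tensmxE mxE eq_sym (negbTE li) mulr0 mul0r.
Qed.

Lemma unstack_rotmx k (Q : 'M[R]_m) (z : 'cV[R]_(k * m)) :
  unstack (rotmx k Q *m z) = unstack z *m Q^T.
Proof.
apply/matrixP => j i; rewrite !mxE big_mxtens (bigD1 j) //= [X in _ + X]big1.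
  rewrite addr0; apply: eq_bigr => l _.
  by rewrite tensmxE !mxE eqxx mul1r mulrC.
move=> l lj; rewrite big1 // => i' _.
by rewrite tensmxE mxE eq_sym (negbTE lj) !mul0r.
Qed.

Lemma ip_unstack k (z w : 'cV[R]_(k * m)) : ip z w = ip (unstack z) (unstack w).
Proof.
rewrite ip_colE ipE big_mxtens; apply: eq_bigr => j _.
by apply: eq_bigr => i _; rewrite !mxE.
Qed.

Lemma rotmxM k (P Q : 'M[R]_m) : rotmx k P *m rotmx k Q = rotmx k (P *m Q).
Proof. by rewrite /rotmx tensmx_mul mul1mx. Qed.

Lemma tr_rotmx k (Q : 'M[R]_m) : (rotmx k Q)^T = rotmx k Q^T.
Proof. by rewrite /rotmx trmx_tens trmx1. Qed.

Lemma tens11 k l : (1%:M : 'M[R]_k) *t (1%:M : 'M[R]_l) = 1%:M.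
Proof.
apply/matrixP => r s; case: (mxtens_indexP r) => i a.
case: (mxtens_indexP s) => j b; rewrite tensmxE !mxE.
rewrite (can_eq (@mxtens_indexK _ _)) xpair_eqE.
by case: eqP; rewrite ?mul0r // mul1r.
Qed.

Lemma rotmx1 k : rotmx k 1%:M = 1%:M.
Proof. exact: tens11. Qed.

Lemma rotmx_orth k (Q : 'M[R]_m) : Q^T *m Q = 1%:M ->
  (rotmx k Q)^T *m rotmx k Q = 1%:M.
Proof. by move=> QQ; rewrite tr_rotmx rotmxM QQ rotmx1. Qed.

Lemma bar_rotmx p q (A : 'M[R]_(p, q)) (Q : 'M[R]_m) :
  bar m A *m rotmx q Q = rotmx p Q *m bar m A.
Proof. by rewrite /bar /rotmx !tensmx_mul !mul1mx !mulmx1. Qed.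

Lemma barM p q r (A : 'M[R]_(p, q)) (B : 'M[R]_(q, r)) :
  bar m (A *m B) = bar m A *m bar m B.
Proof. by rewrite /bar tensmx_mul mulmx1. Qed.

Lemma barD p q (A B : 'M[R]_(p, q)) : bar m (A + B) = bar m A + bar m B.
Proof. by apply/matrixP => i j; rewrite !mxE mulrDl. Qed.

Lemma tr_bar p q (A : 'M[R]_(p, q)) : (bar m A)^T = bar m A^T.
Proof. by rewrite /bar trmx_tens trmx1. Qed.

Lemma DmxT_mulE k (z w : 'cV[R]_(k * m)) j :
  ((Dmx z)^T *m w) j 0 = \sum_i unstack z j i * unstack w j i.
Proof.
rewrite mxE big_mxtens (bigD1 j) //= [X in _ + X]big1 ?addr0.
  by apply: eq_bigr => i _; rewrite !mxE mxtens_indexK eqxx.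
move=> l lj; rewrite big1 // => i _.
by rewrite !mxE mxtens_indexK (negbTE lj) mul0r.
Qed.

Lemma DmxT_mulC k (z w : 'cV[R]_(k * m)) : (Dmx z)^T *m w = (Dmx w)^T *m z.
Proof.
apply/colP => j; rewrite !DmxT_mulE; apply: eq_bigr => i _; exact: mulrC.
Qed.

Lemma DmxD k (z w : 'cV[R]_(k * m)) : Dmx (z + w) = Dmx z + Dmx w.
Proof. by apply/matrixP => r j; rewrite !mxE; case: eqP; rewrite ?addr0. Qed.

Lemma DmxN k (z : 'cV[R]_(k * m)) : Dmx (- z) = - Dmx z.
Proof. by apply/matrixP => r j; rewrite !mxE; case: eqP; rewrite ?oppr0. Qed.

Lemma DmxB k (z w : 'cV[R]_(k * m)) : Dmx (z - w) = Dmx z - Dmx w.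
Proof. by rewrite DmxD DmxN. Qed.

Lemma fnorm_Dmx k (z : 'cV[R]_(k * m)) : fnorm (Dmx z) = fnorm z.
Proof.
congr Num.sqrt; rewrite ip_colE ipE; apply: eq_bigr => r _.
rewrite (bigD1 (mxtens_unindex r).1) //= big1 ?addr0 ?mxE ?eqxx // => j jr.
by rewrite !mxE eq_sym (negbTE jr) mulr0.
Qed.

Lemma Dmx_rotmx k (Q : 'M[R]_m) (z : 'cV[R]_(k * m)) :
  Dmx (rotmx k Q *m z) = rotmx k Q *m Dmx z.
Proof.
apply/matrixP => r j; case: (mxtens_indexP r) => l a.
rewrite [RHS]mxE big_mxtens (bigD1 j) //= [X in _ = _ + X]big1 ?addr0; last first.
  move=> i ij; rewrite big1 // => b _.
  by rewrite [Dmx _ _ _]mxE mxtens_indexK (negbTE ij) mulr0.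
rewrite mxE mxtens_indexK /=; case: (eqVneq l j) => [->|lj]; last first.
  by rewrite big1 // => b _; rewrite tensmxE mxE (negbTE lj) !mul0r.
rewrite mxE big_mxtens (bigD1 j) //= [X in _ + X]big1 ?addr0; last first.
  move=> i ij; rewrite big1 // => b _.
  by rewrite tensmxE mxE eq_sym (negbTE ij) !mul0r.
by apply: eq_bigr => b _; rewrite [Dmx _ _ _]mxE mxtens_indexK eqxx.
Qed.

(** Cross-Gram matrix of two stacked vectors: the Gram matrix of their
    coordinate rows, [\sum_j z_j w_j^T]. *)
Definition gram k (z w : 'cV[R]_(k * m)) : 'M[R]_m := (unstack z)^T *m unstack w.

Lemma tr_gram k (z w : 'cV[R]_(k * m)) : (gram z w)^T = gram w z.
Proof. by rewrite /gram trmx_mul trmxK. Qed.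

Lemma gramBl k (z1 z2 w : 'cV[R]_(k * m)) :
  gram (z1 - z2) w = gram z1 w - gram z2 w.
Proof. by rewrite /gram unstackB linearB /= mulmxBl. Qed.

Lemma gram_rotmx k (S T : 'M[R]_m) (z w : 'cV[R]_(k * m)) :
  gram (rotmx k S *m z) (rotmx k T *m w) = S *m gram z w *m T^T.
Proof. by rewrite /gram !unstack_rotmx trmx_mul trmxK !mulmxA. Qed.

Lemma ip_rotmx k (S : 'M[R]_m) (z w : 'cV[R]_(k * m)) :
  ip z (rotmx k S *m w) = ip S (gram z w).
Proof.
by rewrite ip_unstack unstack_rotmx /ip /gram mulmxA [RHS]mxtrace_mulC.
Qed.

(** Skew and symmetric matrices are orthogonal for the trace form. *)
Lemma ip_skew_sym (S M : 'M[R]_m) : S^T = - S -> M^T = M -> ip S M = 0.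
Proof.
move=> skS symM; suff : ip S M = - ip S M by lra.
rewrite {1}/ip skS mulNmx linearN /=; congr (- _).
by rewrite ipC /ip symM mxtrace_mulC.
Qed.

End StackedAlgebra.

(** * Continuity and compactness in spaces of matrices *)

Section MatrixTopology.
Local Open Scope classical_set_scope.
Variable R : realType.

Section Convergence.
Context {T : Type} {F : set_system T} {FF : Filter F}.

Lemma cvg_entrywise p q (f : T -> 'M[R]_(p, q)) (l : 'M[R]_(p, q)) :
  (forall i j, f x i j @[x --> F] --> l i j) -> f @ F --> l.
Proof.
move=> fl; apply/cvgrPdist_le => /= e e0; near=> x.
rewrite /Num.Def.normr/= mx_normrE (bigmax_le _ (ltW e0))//= => i _.
rewrite !mxE; move: i; near: x; apply: filter_forall => /= i.
exact: ((cvgrPdist_le _ _).1 (fl i.1 i.2)).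
Unshelve. all: by end_near. Qed.

Lemma cvg_entry p q (f : T -> 'M[R]_(p, q)) (l : 'M[R]_(p, q)) i j :
  f @ F --> l -> f x i j @[x --> F] --> l i j.
Proof. by move=> fl; apply: (continuous_cvg _ (@coord_continuous _ _ _ i j l)). Qed.

Lemma cvg_bigsum (I : Type) (r : seq I) (P : pred I) (f : I -> T -> R) (l : I -> R) :
  (forall i, f i x @[x --> F] --> l i) ->
  \sum_(i <- r | P i) f i x @[x --> F] --> \sum_(i <- r | P i) l i.
Proof. by move=> fl; apply: (cvg_big add_continuous). Qed.

Lemma cvg_mulmx p q r (f : T -> 'M[R]_(p, q)) (g : T -> 'M[R]_(q, r))
    (a : 'M[R]_(p, q)) (b : 'M[R]_(q, r)) :
  f @ F --> a -> g @ F --> b -> f x *m g x @[x --> F] --> a *m b.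
Proof.
move=> fa gb; apply: cvg_entrywise => i j; rewrite mxE.
under eq_cvg do rewrite mxE.
by apply: cvg_bigsum => k; apply: cvgM; exact: cvg_entry.
Qed.

Lemma cvg_trmx p q (f : T -> 'M[R]_(p, q)) (a : 'M[R]_(p, q)) :
  f @ F --> a -> (f x)^T @[x --> F] --> a^T.
Proof.
move=> fa; apply: cvg_entrywise => i j; rewrite mxE.
by under eq_cvg do rewrite mxE; exact: cvg_entry.
Qed.

Lemma cvg_ip p q (f g : T -> 'M[R]_(p, q)) (a b : 'M[R]_(p, q)) :
  f @ F --> a -> g @ F --> b -> ip (f x) (g x) @[x --> F] --> ip a b.
Proof.
move=> fa gb; apply: cvg_bigsum => k; apply: cvg_entry.
by apply: cvg_mulmx => //; exact: cvg_trmx.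
Qed.

Lemma cvg_fnorm p q (f : T -> 'M[R]_(p, q)) (a : 'M[R]_(p, q)) :
  f @ F --> a -> fnorm (f x) @[x --> F] --> fnorm a.
Proof.
by move=> fa; apply: (continuous_cvg _ (@sqrt_continuous _ _)); exact: cvg_ip.
Qed.

Lemma cvg_det k (f : T -> 'M[R]_k) (a : 'M[R]_k) :
  f @ F --> a -> \det (f x) @[x --> F] --> \det a.
Proof.
move=> fa; apply: cvg_bigsum => s; apply: cvgM; first exact: cvg_cst.
by apply: (cvg_big mul_continuous) => i _; exact: cvg_entry.
Qed.

Lemma cvg_Dmx m k (f : T -> 'cV[R]_(k * m)) (a : 'cV[R]_(k * m)) :
  f @ F --> a -> Dmx (f x) @[x --> F] --> Dmx a.
Proof.
move=> fa; apply: cvg_entrywise => r j; rewrite mxE.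
under eq_cvg do rewrite mxE.
by case: ifP => _; [exact: cvg_entry|exact: cvg_cst].
Qed.

End Convergence.

Lemma normr_le_fnorm p q (A : 'M[R]_(p, q)) : `|A| <= fnorm A.
Proof.
rewrite /Num.Def.normr /= mx_normrE bigmax_le ?fnorm_ge0 // => i _.
exact: fnorm_entry.
Qed.

(** Heine-Borel for matrices, transported from row vectors by [vec_mx]. *)
Lemma compact_mx p q (A : set 'M[R]_(p, q)) (M : R) :
  (forall x, A x -> fnorm x <= M) -> closed A -> compact A.
Proof.
move=> AM clA.
have vc : continuous (@vec_mx R p q).
  move=> u; apply: (@cvg_entrywise _ (nbhs u)) => i j; rewrite mxE.
  under eq_cvg do rewrite mxE.
  exact: coord_continuous.
have -> : A = vec_mx @` ((@vec_mx R p q) @^-1` A).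
  rewrite eqEsubset; split => [x Ax|_ [u Au <-] //].
  by exists (mxvec x); rewrite /= mxvecK.
apply: continuous_compact; first exact: continuous_subspaceT.
apply: bounded_closed_compact; last first.
  by move/continuous_closedP : vc; apply.
exists M; split => [|N MN u Au]; first exact: num_real.
apply: le_trans (normr_le_fnorm _) _; apply: le_trans (ltW MN).
have -> : fnorm u = fnorm (vec_mx u : 'M[R]_(p, q)).
  congr Num.sqrt; rewrite !ipE big_ord1.
  rewrite (reindex _ (curry_mxvec_bij p q)) /= pair_bigA /=.
  by apply: eq_bigr => -[i j] _ /=; rewrite !mxE.
exact: AM.
Qed.

End MatrixTopology.

(** * Best rotations *)

Section Alignment.
Local Open Scope classical_set_scope.
Variables (R : realType) (m : nat).

Lemma SO1 : SO m (1%:M : 'M[R]_m).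
Proof. by split; rewrite ?trmx1 ?mulmx1 ?det1. Qed.

Lemma SO_mul (P Q : 'M[R]_m) : SO m P -> SO m Q -> SO m (P *m Q).
Proof.
move=> [PP dP] [QQ dQ]; split; last by rewrite det_mulmx dP dQ mulr1.
by rewrite trmx_mul -mulmxA (mulmxA P^T) PP mul1mx.
Qed.

Lemma SO_tr (Q : 'M[R]_m) : SO m Q -> SO m Q^T.
Proof. by move=> [QQ dQ]; split; rewrite ?trmxK ?det_tr // mulmx1C. Qed.

Lemma compact_SO : compact (SO m : set 'M[R]_m).
Proof.
apply: (@compact_mx _ _ _ _ (Num.sqrt m%:R)) => [Q [QQ _]|].
  by rewrite /fnorm /ip QQ mxtrace1.
have -> : SO m = (fun Q : 'M[R]_m => fnorm (Q^T *m Q - 1%:M)) @^-1` [set x | x = 0]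
    `&` (fun Q : 'M[R]_m => \det Q) @^-1` [set x | x = 1].
  rewrite eqEsubset; split => [Q [QQ dQ]|Q [/= /fnorm_eq0/subr0_eq QQ dQ]] //.
  by split => //=; rewrite QQ subrr fnorm0.
have cl (f : 'M[R]_m -> R) c : continuous f -> closed (f @^-1` [set x | x = c]).
  by move/continuous_closedP; apply; exact: closed_eq.
apply: closedI; apply: cl => Q; last first.
  by apply: (@cvg_det _ _ (nbhs Q)); exact: cvg_id.
apply: (@cvg_fnorm _ _ (nbhs Q)); apply: cvgB; last exact: cvg_cst.
by apply: (@cvg_mulmx _ _ (nbhs Q)); [apply: (@cvg_trmx _ _ (nbhs Q))|]; exact: cvg_id.
Qed.

(** [2 N - 1] is the Cayley transform [(1 + t S) (1 - t S)^-1], and the inverse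
    [N] is a polynomial in [S] when [S ^ 3 = - S]. *)
Lemma cayley_SO (S : 'M[R]_m) (t : R) : S^T = - S -> S *m S *m S = - S ->
  SO m (2 *: (1%:M + (t / (1 + t ^+ 2)) *: S + (t ^+ 2 / (1 + t ^+ 2)) *: (S *m S))
        - 1%:M).
Proof.
move=> skS S3; set N := (_ + _ *: (S *m S)).
have D0 : 1 + t ^+ 2 != 0 by have := sqr_ge0 t; lra.
have SN : (1%:M - t *: S) *m N = 1%:M.
  rewrite /N !mulmxDr !mulmxBl !mulmx1 !mul1mx -!scalemxAl -!scalemxAr mulmxA S3.
  rewrite !scalerA; move: (S *m S) (1%:M : 'M[R]_m) => S2 I1.
  by apply/matrixP => i j; rewrite !mxE; field; exact: D0.
have NS := mulmx1C SN.
have TS : (1%:M - t *: S)^T = 1%:M + t *: S.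
  by rewrite linearB linearZ /= skS trmx1 scalerN opprK.
have NtS : N^T *m (1%:M + t *: S) = 1%:M by rewrite -TS -trmx_mul SN trmx1.
have -> : 2 *: N - 1%:M = (1%:M + t *: S) *m N.
  rewrite -[in LHS]SN mulmxBl mulmxDl mul1mx -!scalemxAl scaler_nat mulr2n.
  by apply/matrixP => i j; rewrite !mxE; ring.
split.
  rewrite trmx_mul -TS trmxK TS -mulmxA (mulmxA (1%:M - _)).
  have -> : (1%:M - t *: S) *m (1%:M + t *: S) = (1%:M + t *: S) *m (1%:M - t *: S).
    rewrite mulmxBl mulmxDl !mulmxDr !mulmxN !mul1mx !mulmx1 opprD.
    by rewrite addrACA [t *: S - _]addrC addrACA.
  by rewrite !mulmxA NtS mul1mx SN.
by rewrite det_mulmx -TS det_tr -det_mulmx SN det1.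
Qed.

(** Generators of the rotations in the coordinate planes. *)
Lemma skew_delta (i j : 'I_m) : i != j ->
  let S : 'M[R]_m := delta_mx i j - delta_mx j i in
  S^T = - S /\ S *m S *m S = - S.
Proof.
move=> ij S; have ji : j != i by rewrite eq_sym.
split; first by rewrite /S linearB /= !trmx_delta opprB.
have -> : S *m S = - (delta_mx i i + delta_mx j j).
  rewrite /S mulmxBl !mulmxBr !mul_delta_mx !mul_delta_mx_0 //.
  by rewrite sub0r subr0 opprD.
rewrite mulNmx mulmxDl; congr (- _).
rewrite /S !mulmxBr !mul_delta_mx !mul_delta_mx_0 //.
by rewrite subr0 sub0r.
Qed.

Lemma ip_delta p q (i : 'I_p) (j : 'I_q) (M : 'M[R]_(p, q)) :
  ip (delta_mx i j) M = M i j.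
Proof.
rewrite ipE (bigD1 i) //= (bigD1 j) //= !big1 ?addr0.
- by rewrite mxE !eqxx mul1r.
- by move=> l li; rewrite big1 // => s _; rewrite mxE (negbTE li) mul0r.
- by move=> l lj; rewrite mxE (negbTE lj) andbF mul0r.
Qed.

Lemma quadratic_le0 (a b : R) : (forall t, t * b + t ^+ 2 * a <= 0) -> b = 0.
Proof.
move=> /(_ (b / (1 + a ^+ 2))); set D := 1 + a ^+ 2.
have D0 : 0 < D by have := sqr_ge0 a; rewrite /D; lra.
(* At [t = b / (1 + a ^ 2)] the quadratic has the sign of
   [b ^ 2 * (1 + a + a ^ 2)], which is nonnegative. *)
have -> : b / D * b + (b / D) ^+ 2 * a = b ^+ 2 * (D + a) / D ^+ 2.
  by field; rewrite gt_eqF.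
rewrite pmulr_lle0 ?invr_gt0 ?exprn_gt0 // pmulr_lle0.
  by move=> h; apply/eqP; rewrite -sqrf_eq0 eq_le h sqr_ge0.
by rewrite /D; have := sqr_ge0 (1 + 2 * a); lra.
Qed.

(** First-order optimality of the identity along the one-parameter subgroups
    of rotations in the coordinate planes. *)
Lemma SO_max_sym (M : 'M[R]_m) :
  (forall Q, SO m Q -> ip Q M <= ip 1%:M M) -> M^T = M.
Proof.
move=> maxM; apply/matrixP => i j; rewrite mxE.
have [->//|ij] := eqVneq i j.
have [] := skew_delta ij; set S := _ - _ => skS S3.
have ipS : ip S M = M i j - M j i.
  by rewrite /S ipBl !ip_delta.
suff : ip S M = 0 by rewrite ipS; lra.
clearbody S => {ipS}.
apply: (@quadratic_le0 (ip (S *m S) M)) => t.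
have := maxM _ (cayley_SO t skS S3).
rewrite ipBl ipZl !ipDl !ipZl.
have D0 : 0 < 1 + t ^+ 2 by have := sqr_ge0 t; lra.
move: (ip S M) (ip (S *m S) M) => b a h.
rewrite -(pmulr_lle0 _ (_ : 0 < (1 + t ^+ 2)^-1)) ?invr_gt0 //.
have -> : (t * b + t ^+ 2 * a) / (1 + t ^+ 2) =
    t / (1 + t ^+ 2) * b + t ^+ 2 / (1 + t ^+ 2) * a by ring.
lra.
Qed.

(** Since [|Q zb|] is constant on SO(m), the closest point [Q zb] maximizes the
    linear functional [<z, Q zb>]; symmetry is its first-order condition. *)
Lemma best_rotation k (zb z : 'cV[R]_(k * m)) : exists Q : 'M[R]_m,
  SO m Q /\
  (forall P, SO m P -> fnorm (z - rotmx k Q *m zb) <= fnorm (z - rotmx k P *m zb)) /\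
  (gram z (rotmx k Q *m zb))^T = gram z (rotmx k Q *m zb).
Proof.
have ne : (SO m : set 'M[R]_m) !=set0 by exists 1%:M; exact: SO1.
have [|Q] := @compact_EVT_max _ _ (fun Q => ip Q (gram z zb)) _ ne compact_SO.
  apply: continuous_subspaceT => Q.
  by apply: (@cvg_ip _ _ (nbhs Q)); [exact: cvg_id|exact: cvg_cst].
rewrite inE => SQ maxQ; exists Q; split=> //.
have {}maxQ P : SO m P -> ip P (gram z zb) <= ip Q (gram z zb).
  by move=> SP; apply: maxQ; rewrite inE.
split=> [P SP|].
  have E T : SO m T -> ip (z - rotmx k T *m zb) (z - rotmx k T *m zb) =
      ip z z + ip zb zb - 2 * ip T (gram z zb).
    move=> [TT _]; rewrite ipBl !ipBr (ipC (rotmx k T *m zb) z) ip_rotmx ip_mull mulmxA.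
    by rewrite rotmx_orth // mul1mx; ring.
  by rewrite /fnorm ler_wsqrtr // !E //; have := maxQ P SP; lra.
have -> : gram z (rotmx k Q *m zb) = gram z zb *m Q^T.
  by rewrite -[z in LHS]mul1mx -(rotmx1 _ m) gram_rotmx mul1mx.
apply: SO_max_sym => P SP; have := maxQ _ (SO_mul SP SQ).
case: (SQ) => QQ _.
rewrite /ip trmx_mul trmx1 mul1mx mxtrace_mulC mulmxA => h.
apply: le_trans (_ : \tr (gram z zb *m Q^T *m P^T) <= _).
  by rewrite mxtrace_mulC.
by apply: le_trans h _; rewrite [in leRHS]mxtrace_mulC.
Qed.

End Alignment.

(** * Infinitesimal rigidity *)

Section Rigidity.
Variables (R : realType) (n E m : nat) (G : graph n E).
Local Notation B := (incidence R G).

Lemma unstack_relpos (p : 'cV[R]_(n * m)) : unstack (relpos G p) = B^T *m unstack p.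
Proof. by rewrite /relpos tr_bar unstack_bar. Qed.

Lemma relposB (p q : 'cV[R]_(n * m)) : relpos G (p - q) = relpos G p - relpos G q.
Proof. by rewrite /relpos mulmxBr. Qed.

Lemma relpos_rotmx (Q : 'M[R]_m) (p : 'cV[R]_(n * m)) :
  relpos G (rotmx n Q *m p) = rotmx E Q *m relpos G p.
Proof. by rewrite /relpos tr_bar !mulmxA bar_rotmx. Qed.

Lemma incidence_const : B^T *m (const_mx 1 : 'cV[R]_n) = 0.
Proof.
apply/colP => k; rewrite !mxE (bigD1 (tail G k)) //= (bigD1 (Defs.head G k)) /=; last first.
  by rewrite eq_sym tail_neq_head.
rewrite !mxE !eqxx eq_sym (negbTE (tail_neq_head G k)) !mulr1 big1 ?addr0 ?subrr //.
move=> i /andP[it ih]; rewrite !mxE.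
by rewrite (negbTE it) (negbTE ih) mul0r.
Qed.

Lemma rank_incidence : (0 < n)%N -> (\rank B^T < n)%N.
Proof.
move=> n0; rewrite ltn_neqAle rank_leq_col andbT; apply/negP => full.
have /row_fullP[X XB] : row_full B^T by [].
have := congr1 (mulmx X) incidence_const; rewrite mulmxA XB mul1mx mulmx0.
by move=> /colP/(_ (Ordinal n0)) /eqP; rewrite !mxE oner_eq0.
Qed.

(** If a linear system [A x = 0] in [N] unknowns has as many independent
    equations and independent solutions [T] as needed to fill [N], then the
    columns of [T] span all solutions. *)
Lemma kernel_span N r c (A : 'M[R]_(r, N)) (T : 'M[R]_(N, c)) :
  \rank A = r -> (r + c = N)%N -> 
  (forall x : 'cV_c, A *m (T *m x) = 0) -> (forall x : 'cV_c, T *m x = 0 -> x = 0) ->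
  forall q : 'cV_N, A *m q = 0 -> exists x, q = T *m x.
Proof.
move=> rA rc ATx freeT q Aq.
have AT : A *m T = 0.
  apply/matrixP => i j; have := ATx (delta_mx j 0).
  by rewrite mulmxA -colE => /colP/(_ i); rewrite !mxE.
have Tfree : row_free T^T.
  apply/inj_row_free => v vT; apply: trmx_inj; rewrite trmx0; apply: freeT.
  by rewrite -[T]trmxK -trmx_mul vT trmx0.
have sub : (T^T <= kermx A^T)%MS.
  by apply/sub_kermxP; rewrite -trmx_mul AT trmx0.
have rk : \rank (kermx A^T) = c.
  by rewrite mxrank_ker mxrank_tr rA -rc addKn.
have ks : (kermx A^T <= T^T)%MS.
  have := mxrank_leqif_sup sub; rewrite rk (eqP Tfree) => -[_ <-].
  by rewrite eqxx.
have /submxP[x qx] : (q^T <= T^T)%MS.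
  by apply: submx_trans ks; apply/sub_kermxP; rewrite -trmx_mul Aq trmx0.
by exists x^T; apply: trmx_inj; rewrite trmx_mul trmxK.
Qed.

Variables (pb : 'cV[R]_(n * m)).
Local Notation zb := (relpos G pb).

Definition skew_comb d (S : 'I_d -> 'M[R]_m) (x : 'cV[R]_d) : 'M[R]_m :=
  \sum_a x a 0 *: S a.

Lemma skew_combN d (S : 'I_d -> 'M[R]_m) x :
  (forall a, (S a)^T = - S a) -> (skew_comb S x)^T = - skew_comb S x.
Proof.
move=> skS; rewrite /skew_comb linear_sum -sumrN; apply: eq_bigr => a _.
by rewrite linearZ /= skS scalerN.
Qed.

Definition rotations d (S : 'I_d -> 'M[R]_m) : 'M[R]_(n * m, d) :=
  \matrix_(r, a) (rotmx n (S a) *m pb) r 0.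

Lemma rotationsE d (S : 'I_d -> 'M[R]_m) x :
  rotations S *m x = rotmx n (skew_comb S x) *m pb.
Proof.
apply: unstack_inj; rewrite unstack_rotmx /skew_comb linear_sum mulmx_sumr.
apply/matrixP => j i; rewrite !mxE summxE; apply: eq_bigr => a _.
rewrite linearZ /= -scalemxAr -unstack_rotmx [in RHS]mxE.
by rewrite [unstack _ _ _]mxE mulrC; congr (_ * _); rewrite mxE.
Qed.

Definition translations : 'M[R]_(n * m, 1 * m) := bar m (const_mx 1 : 'cV[R]_n).

(** Dimension count: translations and infinitesimal rotations are infinitesimal
    motions, they are independent by the non-degeneracy hypothesis, and their
    number is the dimension of the kernel of the rigidity matrix. *)
Lemma motion_trivial d (S : 'I_d -> 'M[R]_m) :
  (0 < n)%N -> \rank (rigidity G zb) = E -> (E + (1 * m + d) = n * m)%N ->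
  (forall a, (S a)^T = - S a) ->
  (forall x, rotmx E (skew_comb S x) *m zb = 0 -> x = 0) ->
  forall q, rigidity G zb *m q = 0 ->
  exists2 T : 'M[R]_m, T^T = - T & relpos G q = rotmx E T *m zb.
Proof.
move=> n0 rk dims skS nondeg q Rq.
have relT (y : 'cV_(1 * m)) : relpos G (translations *m y) = 0.
  apply: unstack_inj; rewrite unstack_relpos unstack_bar mulmxA incidence_const.
  by rewrite mul0mx unstack0.
have skz (T : 'M[R]_m) : T^T = - T -> (Dmx zb)^T *m (rotmx E T *m zb) = 0.
  move=> skT; apply/colP => k; rewrite DmxT_mulE unstack_rotmx mxE.
  have -> : \sum_i unstack zb k i * (unstack zb *m T^T) k i =
     ip (row k (unstack zb))^T (T *m (row k (unstack zb))^T).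
    rewrite ip_colE; apply: eq_bigr => i _; rewrite !mxE; congr (_ * _).
    by apply: eq_bigr => j _; rewrite !mxE mulrC.
  have h := ip_mull T (row k (unstack zb))^T (row k (unstack zb))^T.
  by move: h; rewrite ipC skT mulNmx ipNr; lra.
have relx (x : 'cV_(1 * m + d)) : relpos G (row_mx translations (rotations S) *m x) =
    rotmx E (skew_comb S (dsubmx x)) *m zb.
  rewrite -[x in LHS]vsubmxK mul_row_col rotationsE.
  by rewrite /relpos mulmxDr -/(relpos G _) relT add0r -/(relpos G _) relpos_rotmx.
have [|x tx0|x qE] :=
  @kernel_span _ _ _ _ (row_mx translations (rotations S)) rk dims _ _ q Rq.
- by move=> x; rewrite /rigidity -mulmxA -/(relpos G _) relx skz // skew_combN.
- have d0 : dsubmx x = 0.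
    by apply: nondeg; rewrite -relx tx0 /relpos mulmx0.
  move: tx0; rewrite -[x]vsubmxK d0 mul_row_col mulmx0 addr0 => t0.
  suff -> : usubmx x = 0 by rewrite col_mx0.
  apply: unstack_inj; apply/matrixP => i j; rewrite unstack0 mxE ord1.
  have := congr1 (@unstack _ _ _) t0; rewrite unstack_bar unstack0.
  by move=> /matrixP/(_ (Ordinal n0) j); rewrite !mxE big_ord1 !mxE mul1r.
exists (skew_comb S (dsubmx x)); first exact: skew_combN.
by rewrite qE relx.
Qed.

End Rigidity.

Section Nondegeneracy.
Variables (R : realType) (n E m : nat) (G : graph n E).
Local Notation B := (incidence R G).

(** When all edges are parallel to [s], the rigidity matrix factors through the
    transposed incidence matrix, whose rank is less than [n]. *)
Lemma collinear_rank (z : 'cV[R]_(E * m)) (s : 'cV[R]_m) :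
  (0 < n)%N -> s != 0 ->
  (forall k i j, unstack z k i * s j 0 = unstack z k j * s i 0) ->
  (\rank (rigidity G z) < n)%N.
Proof.
move=> n0 s0 par.
have ss : ip s s != 0 by apply: contra s0 => /eqP/ip_eq0 ->.
pose l : 'cV[R]_E := (ip s s)^-1 *: (unstack z *m s).
have zE : unstack z = l *m s^T.
  apply/matrixP => k i; rewrite [RHS]mxE big_ord1 [l _ _]mxE [s^T _ _]mxE.
  rewrite [(_ *m s) _ _]mxE -mulrA mulr_suml.
  apply: (mulfI ss); rewrite mulrA divff // mul1r ip_colE mulr_suml.
  by apply: eq_bigr => j _; rewrite mulrAC -mulrA par mulrCA mulrA.
pose W : 'M[R]_(n, n * m) := \matrix_(i, r)
  (if (mxtens_unindex r).1 == i then s (mxtens_unindex r).2 0 else 0).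
have WE (q : 'cV_(n * m)) : W *m q = unstack q *m s.
  apply/colP => i; rewrite !mxE big_mxtens (bigD1 i) //= [X in _ + X]big1 ?addr0.
    by apply: eq_bigr => j _; rewrite !mxE mxtens_indexK eqxx mulrC.
  move=> i' ii'; rewrite big1 // => j _.
  by rewrite mxE mxtens_indexK (negbTE ii') mul0r.
have -> : rigidity G z = diag_mx l^T *m B^T *m W.
  apply/matrixP => k r; rewrite -[_ k r]mulr1.
  have key (q : 'cV_(n * m)) : rigidity G z *m q = diag_mx l^T *m B^T *m W *m q.
    rewrite /rigidity -mulmxA -/(relpos G q) -!mulmxA WE mulmxA -mulmxA.
    apply/colP => j; rewrite DmxT_mulE unstack_relpos zE.
    rewrite mul_diag_mx mxE [l^T _ _]mxE mulmxA [X in _ = _ * X]mxE mulr_sumr.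
    by apply: eq_bigr => i _; rewrite mxE big_ord1 [s^T _ _]mxE mulrAC mulrA.
  have := congr1 (fun v : 'cV_E => v k 0) (key (delta_mx r 0)).
  by rewrite -!colE !mxE mulr1.
apply: leq_ltn_trans (mxrankM_maxl _ _) _.
apply: leq_ltn_trans (mxrankM_maxr _ _) _.
exact: rank_incidence.
Qed.

End Nondegeneracy.

Lemma rotmx_eq0 (R : realType) m k (T : 'M[R]_m) (z : 'cV[R]_(k * m)) :
  rotmx k T *m z = 0 -> forall j i, \sum_l unstack z j l * T i l = 0.
Proof.
move=> Tz j i; have := congr1 (fun v => unstack v j i) Tz.
rewrite /= unstack_rotmx unstack0 !mxE => h; rewrite -[RHS]h.
by apply: eq_bigr => l _; rewrite !mxE.
Qed.

(** Skew matrices encode rotation velocities: one number in the plane, a vector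
    of the space through the cross product. Indices of [skew3] are modulo 3. *)
Definition skew2 (R : realType) (a : 'I_1) : 'M[R]_2 :=
  delta_mx 0 1 - delta_mx 1 0.

Definition skew3 (R : realType) (a : 'I_3) : 'M[R]_3 :=
  delta_mx (a + 1) (a + 2) - delta_mx (a + 2) (a + 1).

Section SkewKernels.
Variable R : realType.

Lemma skew2_skew a : (@skew2 R a)^T = - @skew2 R a.
Proof. by have [] := @skew_delta R 2 0 1 isT. Qed.

Lemma skew3_skew a : (@skew3 R a)^T = - @skew3 R a.
Proof.
have /(@skew_delta R 3) [] // : a + 1 != a + 2 by rewrite (inj_eq (addrI _)).
Qed.

Lemma ord2P (i : 'I_2) : i = 0 \/ i = 1.
Proof. by case: i => -[|[|//]] ?; [left|right]; exact: val_inj. Qed.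

Lemma ord3P (i : 'I_3) : [\/ i = 0, i = 1 | i = 2].
Proof.
by case: i => -[|[|[|//]]] ?; [apply: Or31|apply: Or32|apply: Or33]; exact: val_inj.
Qed.

Lemma big_ord3 (V : nmodType) (f : 'I_3 -> V) : \sum_i f i = f 0 + f 1 + f 2.
Proof.
rewrite !big_ord_recl big_ord0 addr0 addrA.
by congr (f _ + f _ + f _); exact: val_inj.
Qed.

Lemma big_ord2 (V : nmodType) (f : 'I_2 -> V) : \sum_i f i = f 0 + f 1.
Proof.
rewrite !big_ord_recl big_ord0 addr0.
by congr (f _ + f _); exact: val_inj.
Qed.

Lemma skew2_kernel k (U : 'M[R]_(k, 2)) (x : 'cV_1) : x != 0 ->
  (forall j i, \sum_l U j l * skew_comb (@skew2 R) x i l = 0) -> U = 0.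
Proof.
move=> x0 Ux; apply/matrixP => j i; rewrite mxE.
have {}x0 : x 0 0 != 0.
  by apply: contra x0 => /eqP x0; apply/eqP/colP => a; rewrite ord1 mxE.
apply: (mulfI x0); rewrite mulr0; have := Ux j 0; have := Ux j 1.
rewrite !big_ord2 /skew_comb !big_ord1 !mxE /= => h1 h0.
by case: (ord2P i) => ->; lra.
Qed.

Lemma skew3_kernel k (U : 'M[R]_(k, 3)) (x : 'cV_3) :
  (forall j i, \sum_l U j l * skew_comb (@skew3 R) x i l = 0) ->
  forall j i l, U j i * x l 0 = U j l * x i 0.
Proof.
move=> Ux j i l; have := Ux j 0; have := Ux j 1; have := Ux j 2.
rewrite !big_ord3 /skew_comb !big_ord3 !mxE /= => h1 h0 h2.
by case: (ord3P i) => ->; case: (ord3P l) => ->; lra.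
Qed.

End SkewKernels.

Section Kernel.
Variables (R : realType) (n E m : nat) (G : graph n E) (pb : 'cV[R]_(n * m)).
Local Notation zb := (relpos G pb).

(** Non-degeneracy of the framework comes from the rank: in the plane some edge
    is nonzero, and in space the edges are not all parallel, since
    [3 n - 6 >= n] for [n >= 3]. Without edges there is nothing to show. *)
Lemma rigid_motion (q : 'cV[R]_(n * m)) :
  (2 <= n)%N -> inf_min_rigid G pb -> rigidity G zb *m q = 0 ->
  exists2 T : 'M[R]_m, T^T = - T & relpos G q = rotmx E T *m zb.
Proof.
move=> n2 rigid Rq; have n0 : (0 < n)%N by apply: leq_trans n2.
have [E0|E0] := posnP E.
  exists 0; first by rewrite trmx0 oppr0.
  apply: unstack_inj; apply/matrixP => k; have := ltn_ord k.
  by rewrite [X in (_ < X)%N]E0.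
case: rigid => -[m2 rk En].
  move: pb q rk Rq; rewrite m2 => pb' q' rk Rq.
  apply: (@motion_trivial _ _ _ _ _ _ 1 (@skew2 R)) => //.
  - by rewrite En; lia.
  - exact: skew2_skew.
  move=> x /rotmx_eq0 xz; apply/eqP; apply: contraT => x0.
  have z0 : relpos G pb' = 0.
    by apply: unstack_inj; rewrite (skew2_kernel x0 xz) unstack0.
  move: rk E0; rewrite z0 /rigidity.
  have -> : Dmx (0 : 'cV[R]_(E * 2)) = 0.
    by apply/matrixP => r j; rewrite !mxE; case: ifP.
  by rewrite trmx0 mul0mx mxrank0 => <-.
move: pb q rk Rq; rewrite m2 => pb' q' rk Rq.
apply: (@motion_trivial _ _ _ _ _ _ 3 (@skew3 R)) => //.
- by rewrite En; lia.
- exact: skew3_skew.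
move=> x /rotmx_eq0 xz; apply/eqP; apply: contraT => x0.
have := collinear_rank G n0 x0 (skew3_kernel xz).
by rewrite rk En; lia.
Qed.

(** By [rigid_motion] the displacement is [T zb] with [T] skew, and it is
    orthogonal to such vectors by the symmetry of the cross-Gram matrix. *)
Lemma rigid_kernel (q : 'cV[R]_(n * m)) :
  (2 <= n)%N -> inf_min_rigid G pb -> (Dmx zb)^T *m relpos G q = 0 ->
  (gram (relpos G q) zb)^T = gram (relpos G q) zb -> relpos G q = 0.
Proof.
move=> n2 rigid Dq sym.
have [|T skT qT] := @rigid_motion q n2 rigid; first by rewrite /rigidity -mulmxA.
by apply: ip_eq0; rewrite {2}qT ip_rotmx ip_skew_sym.
Qed.

(** Antisymmetric part of the cross-Gram matrix with [zb], as a linear map. *)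
Definition gram_skew : 'M[R]_(m * m, E * m) := \matrix_(a, r)
  (rotmx E (delta_mx (mxtens_unindex a).1 (mxtens_unindex a).2 -
     delta_mx (mxtens_unindex a).2 (mxtens_unindex a).1) *m zb) r 0.

Lemma gram_skewE (w : 'cV[R]_(E * m)) i j :
  (gram_skew *m w) (mxtens_index (i, j)) 0 = gram w zb i j - gram w zb j i.
Proof.
have -> : gram w zb i j - gram w zb j i = ip (delta_mx i j - delta_mx j i) (gram w zb).
  by rewrite ipBl !ip_delta.
rewrite -ip_rotmx mxE ip_colE.
by apply: eq_bigr => r _; rewrite [gram_skew _ _]mxE mxtens_indexK mulrC.
Qed.

Lemma gram_skew_sym (w : 'cV[R]_(E * m)) :
  gram_skew *m w = 0 <-> (gram w zb)^T = gram w zb.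
Proof.
split=> [w0|sym].
  apply/matrixP => i j; rewrite mxE; have := gram_skewE w j i.
  by rewrite w0 mxE; lra.
apply/colP => a; case: (mxtens_indexP a) => i j.
by rewrite gram_skewE -[in X in _ - X]sym [X in _ - X]mxE subrr mxE.
Qed.

(** The quantitative form of [rigid_kernel]. *)
Lemma rigid_coercive : (2 <= n)%N -> inf_min_rigid G pb ->
  exists2 C : R, 0 < C & forall q : 'cV[R]_(n * m),
    (gram (relpos G q) zb)^T = gram (relpos G q) zb ->
    fnorm (relpos G q) <= C * fnorm ((Dmx zb)^T *m relpos G q).
Proof.
move=> n2 rigid; pose A := col_mx (Dmx zb)^T gram_skew *m (bar m (incidence R G))^T.
have [q|C C0 CA] := @ker_sub_bound _ _ _ _ A (bar m (incidence R G))^T.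
  rewrite /A -mulmxA -/(relpos G q) mul_col_mx => /eqP.
  rewrite col_mx_eq0 => /andP[/eqP Dq /eqP/gram_skew_sym sym].
  exact: rigid_kernel.
exists C => // q /gram_skew_sym sym; have := CA q.
rewrite /A -mulmxA -/(relpos G q) mul_col_mx sym.
congr (_ <= _ * _); apply/eqP; rewrite -(@eqrXn2 _ 2) ?fnorm_ge0 //.
by rewrite fnorm_col_mx fnorm0 expr0n addr0.
Qed.

End Kernel.

(** * Distance to the shape and edge-length errors *)

Section ErrorBound.
Local Open Scope classical_set_scope.
Variables (R : realType) (n E m : nat) (G : graph n E) (pb : 'cV[R]_(n * m)).
Local Notation zb := (relpos G pb).

Lemma errE (w z : 'cV[R]_(E * m)) : err w z = (Dmx z)^T *m z - (Dmx w)^T *m w.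
Proof.
have E0 (x : 'cV[R]_(E * m)) k : enorm (block x k) ^+ 2 = ((Dmx x)^T *m x) k 0.
  rewrite enormE sqr_fnorm ip_colE DmxT_mulE.
  by apply: eq_bigr => i _; rewrite !mxE.
by apply/colP => k; rewrite [LHS]mxE !E0 !mxE.
Qed.

Lemma err_rotmx (w z : 'cV[R]_(E * m)) (Q : 'M[R]_m) :
  SO m Q -> err w (rotmx E Q *m z) = err w z.
Proof.
move=> [QQ _]; rewrite !errE Dmx_rotmx trmx_mul -mulmxA (mulmxA (rotmx E Q)^T).
by rewrite rotmx_orth // mul1mx.
Qed.

Lemma near_shapeP (w z : 'cV[R]_(E * m)) d :
  near_shape w d z <-> exists2 Q, SO m Q & fnorm (z - rotmx E Q *m w) <= d.
Proof.
split=> [[_ [Q SQ ->]]|[Q SQ]]; first by rewrite enormE; exists Q.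
by move=> le; exists (rotmx E Q *m w); [exists Q|rewrite enormE].
Qed.

Lemma near_shape_perturb (w z z' : 'cV[R]_(E * m)) a b :
  near_shape w a z -> fnorm (z' - z) <= b -> near_shape w (a + b) z'.
Proof.
move=> /near_shapeP[Q SQ za] zb'; apply/near_shapeP; exists Q => //.
rewrite -(subrKA z) addrC; apply: le_trans (fnormD _ _) _.
by rewrite lerD.
Qed.

Lemma near_shape_weaken (w z : 'cV[R]_(E * m)) a b :
  a <= b -> near_shape w a z -> near_shape w b z.
Proof. by move=> ab [zs sz za]; exists zs => //; apply: le_trans ab. Qed.

(** At the closest point of the shape the displacement [w] is orthogonal to the
    rotations, so that coercivity applies; the error is [2 D^T w] up to a
    quadratic term. *)
Lemma local_error_bound : (2 <= n)%N -> inf_min_rigid G pb ->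
  exists d0 C : R, [/\ 0 < d0, 0 < C & forall p d, d <= d0 ->
    near_shape zb d (relpos G p) -> exists Q : 'M[R]_m,
    [/\ SO m Q, fnorm (relpos G p - rotmx E Q *m zb) <= d &
        fnorm (relpos G p - rotmx E Q *m zb) <= C * fnorm (err zb (relpos G p))]].
Proof.
move=> n2 rigid; have [C C0 coer] := rigid_coercive n2 rigid.
exists C^-1, C; split; rewrite ?invr_gt0 // => p d dC /near_shapeP[P SP Pd].
have [Q [SQ [best sym]]] := best_rotation zb (relpos G p).
have Qd := le_trans (best _ SP) Pd.
exists Q; split => //.
have [QQ _] := SQ; have QQ' := mulmx1C QQ.
pose w := relpos G (rotmx n Q^T *m p - pb).
have zE : relpos G p = rotmx E Q *m (zb + w).
  rewrite /w relposB relpos_rotmx addrC subrK mulmxA rotmxM QQ' rotmx1.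
  by rewrite mul1mx.
have wE : relpos G p - rotmx E Q *m zb = rotmx E Q *m w.
  by rewrite zE mulmxDr addrAC subrr add0r.
have nw : fnorm (relpos G p - rotmx E Q *m zb) = fnorm w.
  by rewrite wE fnorm_orth // rotmx_orth.
have symw : (gram w zb)^T = gram w zb.
  rewrite /w relposB gramBl linearB /= [(gram zb zb)^T]tr_gram; congr (_ - _).
  have -> : gram (relpos G (rotmx n Q^T *m p)) zb =
      Q^T *m gram (relpos G p) (rotmx E Q *m zb) *m Q.
    rewrite relpos_rotmx -{1}[zb]mul1mx -(rotmx1 _ m) -QQ -rotmxM -mulmxA gram_rotmx.
    by rewrite trmxK.
  by move: (gram (relpos G p) _) sym => M sym; rewrite !trmx_mul trmxK sym mulmxA.
have errw : err zb (relpos G p) = 2 *: ((Dmx zb)^T *m w) + (Dmx w)^T *m w.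
  rewrite zE err_rotmx // errE DmxD [(_ + _)^T]linearD /= mulmxDl !mulmxDr.
  rewrite (DmxT_mulC w zb).
  move: (_ *m zb) (_ *m w) (_ *m w) => x y v.
  by apply/colP => k; rewrite !mxE; ring.
(* Within [1 / C] the quadratic term is absorbed by half of the linear one. *)
rewrite nw; have cw : fnorm w <= C * fnorm ((Dmx zb)^T *m w) by exact: coer.
have e2 : 2 * fnorm ((Dmx zb)^T *m w) <= fnorm (err zb (relpos G p)) + fnorm w ^+ 2.
  have -> : 2 * fnorm ((Dmx zb)^T *m w) = fnorm (2 *: ((Dmx zb)^T *m w)).
    by rewrite fnormZ ger0_norm.
  have -> : 2 *: ((Dmx zb)^T *m w) = err zb (relpos G p) - (Dmx w)^T *m w.
    by rewrite errw addrK.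
  apply: le_trans (fnormD _ _) _; rewrite fnormN lerD2l expr2.
  by apply: le_trans (fnormM _ _) _; rewrite fnorm_tr fnorm_Dmx.
have wd : C * fnorm w <= 1.
  by rewrite -(mulfV (lt0r_neq0 C0)) ler_pM2l // -nw; exact: le_trans dC.
have w0 := fnorm_ge0 w.
have : 2 * fnorm w <= C * fnorm (err zb (relpos G p)) + C * fnorm w * fnorm w.
  apply: le_trans (_ : C * (2 * fnorm ((Dmx zb)^T *m w)) <= _); first lra.
  by rewrite -mulrA -mulrDr ler_pM2l // -expr2.
have : C * fnorm w * fnorm w <= 1 * fnorm w by rewrite ler_wpM2r.
lra.
Qed.

Lemma isolating_local d0 C : (forall p, near_shape zb d0 (relpos G p) ->
    exists Q : 'M[R]_m, [/\ SO m Q, fnorm (relpos G p - rotmx E Q *m zb) <= d0 &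
      fnorm (relpos G p - rotmx E Q *m zb) <= C * fnorm (err zb (relpos G p))]) ->
  isolating G zb d0.
Proof.
move=> bound p /bound[Q [SQ _]] + e0; rewrite e0 fnorm0 mulr0 => z0.
exists Q => //; apply/subr0_eq/fnorm_eq0/eqP.
by rewrite eq_le z0 fnorm_ge0.
Qed.

(** Away from the shape, but within an isolating radius, the error is bounded
    below: after a rotation the configurations in question form a compact set on
    which the error does not vanish. *)
Lemma confinement delta eta : isolating G zb delta -> 0 < eta ->
  exists2 rho : R, 0 < rho & forall p, near_shape zb delta (relpos G p) ->
    fnorm (err zb (relpos G p)) ^+ 2 <= rho -> near_shape zb eta (relpos G p).
Proof.
move=> iso eta0; pose K := cokermx (bar m (incidence R G)).
(* [K] cuts out the range of [relpos]. *)
pose X : set 'cV[R]_(E * m) :=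
  [set z | fnorm (z^T *m K) = 0] `&` [set z | fnorm (z - zb) <= delta] `&`
  \bigcap_(Q in SO m) [set z | eta <= fnorm (z - rotmx E Q *m zb)].
have relX z : fnorm (z^T *m K) = 0 -> exists p, z = relpos G p.
  move=> /fnorm_eq0/eqP; rewrite -submxE => /submxP[D zD].
  by exists D^T; apply: trmx_inj; rewrite zD /relpos trmx_mul !trmxK.
have near p : near_shape zb delta (relpos G p) -> ~ near_shape zb eta (relpos G p) ->
    exists2 z, X z & fnorm (err zb z) = fnorm (err zb (relpos G p)).
  move=> /near_shapeP[Q SQ Qd] far; have [QQ _] := SQ; have QQ' := mulmx1C QQ.
  have SQt := SO_tr SQ.
  have zE : relpos G p = rotmx E Q *m relpos G (rotmx n Q^T *m p).
    by rewrite relpos_rotmx mulmxA rotmxM QQ' rotmx1 mul1mx.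
  exists (relpos G (rotmx n Q^T *m p)); last by rewrite [in RHS]zE err_rotmx.
  split; first split => /=.
  - by rewrite /relpos trmx_mul trmxK -mulmxA mulmx_coker mulmx0 fnorm0.
  - by move: Qd; rewrite [in X in X -> _]zE -mulmxBr fnorm_orth // rotmx_orth.
  move=> P SP /=; rewrite leNgt; apply/negP => lt; apply: far.
  apply/near_shapeP; exists (Q *m P); first exact: SO_mul.
  by rewrite zE -rotmxM -mulmxA -mulmxBr fnorm_orth ?rotmx_orth // ltW.
have [X0|X0] := pselect (X !=set0); last first.
  exists 1 => // p nd _; have [//|far] := pselect (near_shape zb eta (relpos G p)).
  by have [z Xz _] := near p nd far; case: X0; exists z.
have cl (f : 'cV[R]_(E * m) -> R) (A : set R) : continuous f -> closed A ->
    closed [set z | A (f z)].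
  by move=> /continuous_closedP cf Acl; exact: cf.
have cB (a : 'cV[R]_(E * m)) : continuous (fun z : 'cV[R]_(E * m) => fnorm (z - a)).
  move=> z; apply: (@cvg_fnorm _ _ (nbhs z)).
  by apply: cvgB; [exact: cvg_id|exact: cvg_cst].
have clX : closed X.
  apply: closedI; first apply: closedI.
  - apply: (cl _ [set x | x = 0]); last exact: closed_eq.
    move=> z; apply: (@cvg_fnorm _ _ (nbhs z)); apply: (@cvg_mulmx _ _ (nbhs z)).
      by apply: (@cvg_trmx _ _ (nbhs z)); exact: cvg_id.
    exact: cvg_cst.
  - by apply: (cl _ [set x | x <= delta]); [exact: cB|exact: closed_le].
  apply: closed_bigI => Q _.
  by apply: (cl _ [set x | eta <= x]); [exact: cB|exact: closed_ge].
have coX : compact X.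
  apply: (@compact_mx _ _ _ X (delta + fnorm zb)) => // z [[_ /= zd] _].
  by rewrite -[z](subrK zb); apply: le_trans (fnormD _ _) _; rewrite lerD2r.
have [|c cX cmin] := @compact_EVT_min _ _ (fun z => fnorm (err zb z)) X X0 coX.
  apply: continuous_subspaceT => z; apply: (@cvg_fnorm _ _ (nbhs z)).
  under eq_cvg do rewrite errE.
  rewrite errE; apply: cvgB; last exact: cvg_cst.
  apply: (@cvg_mulmx _ _ (nbhs z)); last exact: cvg_id.
  by apply: (@cvg_trmx _ _ (nbhs z)); apply: (@cvg_Dmx _ _ (nbhs z)); exact: cvg_id.
have c0 : 0 < fnorm (err zb c).
  rewrite lt_neqAle fnorm_ge0 andbT eq_sym; apply/eqP => /fnorm_eq0 e0.
  move: cX; rewrite inE => -[[/relX[p cp] /= cd] far].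
  have [] := iso p.
  - apply/near_shapeP; exists 1%:M; first exact: SO1.
    by rewrite -cp rotmx1 mul1mx.
  - by rewrite -cp.
  move=> Q SQ; rewrite -cp => cQ; have := far Q SQ.
  by rewrite /= {1}cQ subrr fnorm0 leNgt eta0.
exists (fnorm (err zb c) ^+ 2 / 2).
  by rewrite divr_gt0 // exprn_gt0.
move=> p nd small; have [//|far] := pselect (near_shape zb eta (relpos G p)).
have [z Xz ze] := near p nd far.
have := cmin z; rewrite inE ze => /(_ Xz) ce.
have : fnorm (err zb c) ^+ 2 <= fnorm (err zb (relpos G p)) ^+ 2.
  by rewrite ler_pXn2r ?nnegrE ?fnorm_ge0.
have : 0 < fnorm (err zb c) ^+ 2 by rewrite exprn_gt0.
lra.
Qed.

End ErrorBound.

(** * Uniform estimates near the shape *)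

Section Estimates.
Variables (R : realType) (n E m : nat) (G : graph n E) (pb : 'cV[R]_(n * m)).
Local Notation zb := (relpos G pb).
Local Notation B := (bar m (incidence R G)).

(** A vector orthogonal to everything orthogonal to [Ker A] lies in [Ker A]: the
    rows of [A] are orthogonal to [Ker A]. *)
Lemma orthocompl_kernel p q (A : 'M[R]_(p, q)) (X : set 'cV[R]_q) (y : 'cV_q) :
  (forall x, X x -> A *m x = 0) -> orthocompl (orthocompl X) y -> A *m y = 0.
Proof.
move=> XA Xy; apply/colP => i; have -> : (A *m y) i 0 = ((row i A)^T^T *m y) 0 0.
  by rewrite trmxK -row_mul [RHS]mxE.
rewrite (Xy (row i A)^T) ?mxE // => x /XA Ax; apply: trmx_inj.
by rewrite trmx_mul !trmxK -row_mul Ax trmx0; apply/rowP => j; rewrite !mxE.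
Qed.

(** Projecting onto the complement of [Ker T] changes a vector by an element of
    [Ker T], so [B^T T] still vanishes. *)
Lemma Uhat_kernel x : Uhat G zb x -> B^T *m Tmx G zb *m x = 0.
Proof.
move=> [y Ky [_ yx]].
have : Tmx G zb *m (y - x) = 0.
  by apply: orthocompl_kernel yx => w; apply.
by move/(congr1 (mulmx B^T)); rewrite mulmxA mulmxBr mulmx0 Ky sub0r => /eqP;
  rewrite oppr_eq0 => /eqP.
Qed.

(** Here the projection changes a vector by an element of the bi-orthogonal of
    [Uhat], on which [B^T T] vanishes as well. *)
Lemma What_kernel x : What G zb x -> (Dmx zb)^T *m B^T *m Tmx G zb *m x = 0.
Proof.
move=> [y Ky [_ yx]].
have : B^T *m Tmx G zb *m (y - x) = 0.
  by apply: orthocompl_kernel yx => w; exact: Uhat_kernel.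
move/(congr1 (mulmx (Dmx zb)^T)); rewrite !mulmxA mulmxBr mulmx0 Ky sub0r => /eqP.
by rewrite oppr_eq0 => /eqP.
Qed.

(** Half the velocity of the squared edge lengths at [z] when the agents move
    with the reference velocity [A_v z]. *)
Definition drift (mu mut : 'cV[R]_E) (z : 'cV[R]_(E * m)) : 'cV[R]_E :=
  (Dmx z)^T *m (B^T *m (bar m (Av G mu mut) *m z)).

Lemma drift_designed (mu mut : 'cV[R]_E) : designed G zb mu mut -> drift mu mut zb = 0.
Proof.
move=> [muv [mutv [muw [mutw [Uv Ww -> ->]]]]]; rewrite /drift TmxE.
rewrite -add_col_mx !mulmxDr !mulmxA (What_kernel Ww) addr0 -!mulmxA.
by rewrite (mulmxA B^T) (Uhat_kernel Uv) mulmx0.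
Qed.

Lemma drift_rotmx mu mut z (Q : 'M[R]_m) : SO m Q ->
  drift mu mut (rotmx E Q *m z) = drift mu mut z.
Proof.
move=> [QQ _]; rewrite /drift Dmx_rotmx trmx_mul tr_bar.
rewrite (mulmxA (bar m (Av G mu mut))) bar_rotmx -mulmxA (mulmxA (bar m _^T)) bar_rotmx.
by rewrite -mulmxA -mulmxA (mulmxA (rotmx E Q)^T) rotmx_orth // mul1mx !mulmxA.
Qed.

Lemma fnorm_Av (mu mut : 'cV[R]_E) : fnorm (Av G mu mut) = fnorm (col_mx mu mut).
Proof.
apply/eqP; rewrite -(@eqrXn2 _ 2) ?fnorm_ge0 // fnorm_col_mx !sqr_fnorm !ip_colE.
rewrite -big_split ipE exchange_big /=; apply/eqP/eq_bigr => k _.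
rewrite (bigD1 (tail G k)) //= (bigD1 (Defs.head G k)) /=; last first.
  by rewrite eq_sym tail_neq_head.
rewrite !mxE !eqxx eq_sym (negbTE (tail_neq_head G k)) big1 ?addr0 //.
by move=> i /andP[it ih]; rewrite !mxE (negbTE it) (negbTE ih) mulr0.
Qed.

(** A minimally rigid framework has independent rows in its rigidity matrix, so
    the transpose has a left inverse. *)
Lemma edge_coercive : \rank (rigidity G zb) = E ->
  exists2 C : R, 0 < C & forall x : 'cV[R]_E, fnorm x <= C * fnorm (B *m (Dmx zb *m x)).
Proof.
move=> rk; have [x|C C0 bound] := @ker_sub_bound _ _ _ _ (B *m Dmx zb) (1%:M : 'M[R]_E).
- have /row_freeP[X RX] : row_free (rigidity G zb) by rewrite /row_free rk.
  move=> Bx; rewrite mul1mx; apply: trmx_inj; rewrite trmx0 -[x^T]mulmx1 -RX mulmxA.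
  by rewrite /rigidity -[(Dmx zb)^T *m _]trmxK trmx_mul !trmxK -trmx_mul Bx trmx0 mul0mx.
by exists C => // x; have := bound x; rewrite mul1mx mulmxA.
Qed.

(** What the Lyapunov estimate uses about a configuration [z], with a single
    constant. *)
Record uniform_bounds (C : R) (mu mut : 'cV[R]_E) (z : 'cV[R]_(E * m)) : Prop :=
  UniformBounds {
    bound_B : fnorm B <= C;
    bound_z : fnorm z <= C;
    bound_err : fnorm (err zb z) <= C;
    bound_coercive : fnorm (err zb z) <= C * fnorm (B *m (Dmx z *m err zb z));
    bound_Av : fnorm (bar m (Av G mu mut)) <= C * fnorm (col_mx mu mut);
    bound_drift : fnorm (drift mu mut z) <= C * fnorm (col_mx mu mut) * fnorm (err zb z)
  }.

(** The drift vanishes at a point [zs] of the shape near [z], and [B D] is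
    coercive there; both facts extend to [z] by perturbation, as [|z - zs|] is
    small and bounded by the error. *)
Lemma uniform_estimates : (2 <= n)%N -> inf_min_rigid G pb ->
  exists d0 C : R, [/\ 0 < d0, 1 <= C &
    (forall p d, d <= d0 -> near_shape zb d (relpos G p) ->
      (exists Q : 'M[R]_m, [/\ SO m Q, fnorm (relpos G p - rotmx E Q *m zb) <= d &
        fnorm (relpos G p - rotmx E Q *m zb) <= C * fnorm (err zb (relpos G p))]) /\
      forall mu mut, designed G zb mu mut -> uniform_bounds C mu mut (relpos G p))].
Proof.
move=> n2 rigid; have [d1 [C1 [d10 C10 loc]]] := local_error_bound n2 rigid.
have rk : \rank (rigidity G zb) = E by case: rigid => -[].
have [X X0 coer] := edge_coercive rk.
pose b := fnorm B + 1; have b1 : 1 <= b by rewrite /b; have := fnorm_ge0 B; lra.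
(* The radius [1 / (2 X b)] keeps half of the coercivity at the shape. *)
pose d0 := Num.min d1 (2 * X * b)^-1.
pose Z := fnorm zb + d0; pose s := fnorm (1%:M : 'M[R]_m).
have Xb : 0 < 2 * X * b by rewrite !mulr_gt0 //; lra.
have d00 : 0 < d0 by rewrite /d0 lt_min d10 invr_gt0.
have Z0 : 0 <= Z by rewrite /Z addr_ge0 ?fnorm_ge0 // ltW.
have s0 : 0 <= s by exact: fnorm_ge0.
pose C := 1 + C1 + 2 * X + b + Z + (Z * Z + fnorm zb * fnorm zb) + s + C1 * b * s * (2 * Z).
have zz0 : 0 <= Z * Z + fnorm zb * fnorm zb by rewrite addr_ge0 // mulr_ge0 ?fnorm_ge0.
have cc0 : 0 <= C1 * b * s * (2 * Z) by rewrite !mulr_ge0 //; lra.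
exists d0, C; split => //; first by rewrite /C; lra.
move=> p d dd0 nd.
have [|Q [SQ Qd Qe]] := loc p d _ nd.
  by apply: le_trans dd0 _; rewrite /d0 ge_min lexx.
set z := relpos G p in nd Qd Qe *; set zs := rotmx E Q *m zb in Qd Qe *.
set e := err zb z in Qe *.
have e0 : 0 <= fnorm e by exact: fnorm_ge0.
have [QQ _] := SQ.
have nzs : fnorm zs = fnorm zb by rewrite /zs fnorm_orth // rotmx_orth.
have zZ : fnorm z <= Z.
  rewrite -[z](subrK zs); apply: le_trans (fnormD _ _) _; rewrite nzs /Z; lra.
split.
  exists Q; split => //; apply: le_trans Qe _; rewrite ler_wpM2r // /C; lra.
move=> mu mut des; set r := fnorm (col_mx mu mut).
have r0 : 0 <= r by exact: fnorm_ge0.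
have Avb : fnorm (bar m (Av G mu mut)) <= s * r.
  by rewrite /bar fnorm_tens fnorm_Av mulrC.
split.
- by apply: (@le_trans _ _ b); [rewrite /b lerDl|rewrite /C; lra].
- by apply: le_trans zZ _; rewrite /C; lra.
- apply: (@le_trans _ _ (Z * Z + fnorm zb * fnorm zb)); last by rewrite /C; lra.
  rewrite errE; apply: le_trans (fnormD _ _) _; rewrite fnormN lerD //.
    apply: le_trans (fnormM _ _) _; rewrite fnorm_tr fnorm_Dmx.
    by rewrite ler_pM ?fnorm_ge0.
  by apply: le_trans (fnormM _ _) _; rewrite fnorm_tr fnorm_Dmx.
- rewrite -/e; apply: (@le_trans _ _ (2 * X * fnorm (B *m (Dmx z *m e)))); last first.
    by rewrite ler_wpM2r ?fnorm_ge0 // /C; lra.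
  have h1 : fnorm e <= X * fnorm (B *m (Dmx zs *m e)).
    have -> : fnorm (B *m (Dmx zs *m e)) = fnorm (B *m (Dmx zb *m e)).
      rewrite Dmx_rotmx -mulmxA mulmxA bar_rotmx -mulmxA fnorm_orth //.
      by rewrite rotmx_orth.
    exact: coer.
  have h2 : fnorm (B *m (Dmx zs *m e)) <=
      fnorm (B *m (Dmx z *m e)) + b * (d0 * fnorm e).
    have -> : B *m (Dmx zs *m e) = B *m (Dmx z *m e) - B *m (Dmx (z - zs) *m e).
      by rewrite DmxB mulmxBl mulmxBr opprB addrC subrK.
    apply: le_trans (fnormD _ _) _; rewrite fnormN lerD2l.
    apply: le_trans (fnormM _ _) _; apply: ler_pM; rewrite ?fnorm_ge0 //.
      by rewrite /b lerDl.
    apply: le_trans (fnormM _ _) _; rewrite fnorm_Dmx ler_wpM2r //.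
    exact: le_trans dd0.
  have h3 : X * (b * (d0 * fnorm e)) <= fnorm e / 2.
    have -> : X * (b * (d0 * fnorm e)) = (2 * X * b * d0) * (fnorm e / 2) by field.
    rewrite ler_piMl ?divr_ge0 // -ler_pdivlMl // mulr1.
    by rewrite /d0 ge_min lexx orbT.
  have : X * fnorm (B *m (Dmx zs *m e)) <=
      X * (fnorm (B *m (Dmx z *m e)) + b * (d0 * fnorm e)) by rewrite ler_pM2l.
  rewrite mulrDr; lra.
- by apply: le_trans Avb _; rewrite ler_wpM2r // /C; lra.
have -> : drift mu mut z = (Dmx (z - zs))^T *m (B^T *m (bar m (Av G mu mut) *m z)) +
    (Dmx zs)^T *m (B^T *m (bar m (Av G mu mut) *m (z - zs))).
  rewrite DmxB linearB /= mulmxBl !mulmxBr -!/(drift _ _ _) addrA subrK.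
  by rewrite drift_rotmx // drift_designed // subr0.
apply: (@le_trans _ _ (C1 * b * s * (2 * Z) * r * fnorm e)); last first.
  by rewrite !ler_wpM2r // /C; lra.
have step (x y : 'cV[R]_(E * m)) :
    fnorm ((Dmx x)^T *m (B^T *m (bar m (Av G mu mut) *m y))) <=
    fnorm x * (b * (s * r * fnorm y)).
  apply: le_trans (fnormM _ _) _; rewrite fnorm_tr fnorm_Dmx ler_wpM2l ?fnorm_ge0 //.
  apply: le_trans (fnormM _ _) _; rewrite fnorm_tr; apply: ler_pM; rewrite ?fnorm_ge0 //.
    by rewrite /b lerDl.
  by apply: le_trans (fnormM _ _) _; rewrite ler_wpM2r ?fnorm_ge0.
apply: le_trans (fnormD _ _) _.
have bsr : 0 <= b * (s * r) by rewrite !mulr_ge0 //; lra.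
have zsZ : fnorm zs <= Z by rewrite nzs /Z; lra.
have t1 := step (z - zs) z; have t2 := step zs (z - zs).
have u1 : fnorm (z - zs) * (b * (s * r * fnorm z)) <= C1 * fnorm e * (b * (s * r) * Z).
  rewrite [b * _]mulrA; apply: ler_pM; rewrite ?(mulr_ge0 bsr) ?fnorm_ge0 //.
  by rewrite ler_wpM2l.
have u2 : fnorm zs * (b * (s * r * fnorm (z - zs))) <= Z * (b * (s * r) * (C1 * fnorm e)).
  rewrite [b * _]mulrA; apply: ler_pM; rewrite ?(mulr_ge0 bsr) ?fnorm_ge0 //.
  by rewrite ler_wpM2l.
lra.
Qed.

End Estimates.

(** * A strict Lyapunov function *)

Section Lyapunov.
Variables (R : realType) (n E m : nat) (G : graph n E) (pb : 'cV[R]_(n * m)).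
Variables (mu mut : 'cV[R]_E).
Local Notation zb := (relpos G pb).
Local Notation B := (bar m (incidence R G)).
Local Notation A := (bar m (Av G mu mut)).

Definition lyap (eps : R) (e : 'cV[R]_E) (z : 'cV[R]_(E * m)) (ev : 'cV[R]_(n * m)) : R :=
  (eps + 1) / 4 * ip e e + 1 / 2 * ip ev ev + eps * ip e ((Dmx z)^T *m (B^T *m ev)).

(** Derivative of [lyap] along a motion with velocities [e'], [z'] and [ev']. *)
Definition lyap_dot (eps : R) (e : 'cV[R]_E) (z : 'cV[R]_(E * m)) (ev : 'cV[R]_(n * m))
    (e' : 'cV[R]_E) (z' : 'cV[R]_(E * m)) (ev' : 'cV[R]_(n * m)) : R :=
  (eps + 1) / 2 * ip e e' + ip ev ev' +
  eps * (ip e' ((Dmx z)^T *m (B^T *m ev)) + ip e ((Dmx z')^T *m (B^T *m ev)) +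
         ip e ((Dmx z)^T *m (B^T *m ev'))).

(** The feedforward [A_a z = A B^T A z] compensates the acceleration [A B^T v] of
    the reference velocity up to [- A B^T ev]. *)
Lemma closed_loop_verr (p v : 'cV[R]_(n * m)) :
  let z := relpos G p in let ev := verr G mu mut p v in
  control G zb 1 1 mu mut p v - A *m (B^T *m v) =
  - ev - B *m (Dmx z *m err zb z) - A *m (B^T *m ev).
Proof.
rewrite /= /control /verr /Aa !scale1r.
rewrite barD !barM -tr_bar mulmxDl -!mulmxA !scaleN1r !mulmxBr.
move: (A *m relpos G p) => Az; move: (B *m _) (A *m (B^T *m v)) (A *m (B^T *m Az)).
by move=> x y w; apply/colP => i; rewrite !mxE; ring.
Qed.

Lemma closed_loop_relpos (p v : 'cV[R]_(n * m)) :
  B^T *m v = B^T *m verr G mu mut p v + B^T *m (A *m relpos G p).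
Proof. by rewrite /verr mulmxBr subrK. Qed.

(** The weight [(eps + 1) / 4] of [ip e e] is the one for which the terms
    [ip e g] cancel; the mixed term of [lyap] contributes the damping of [e]. *)
Lemma lyap_dotE eps (p v : 'cV[R]_(n * m)) :
  let z := relpos G p in let ev := verr G mu mut p v in let e := err zb z in
  let f := drift G mu mut z in let g := (Dmx z)^T *m (B^T *m ev) in
  lyap_dot eps e z ev (2 *: ((Dmx z)^T *m (B^T *m v))) (B^T *m v)
    (control G zb 1 1 mu mut p v - A *m (B^T *m v)) =
  (eps + 1) * ip e f - ip ev ev - ip ev (A *m (B^T *m ev)) +
  eps * (2 * ip g g + 2 * ip f g + ip e ((Dmx (B^T *m v))^T *m (B^T *m ev))
    - ip (B *m (Dmx z *m e)) (B *m (Dmx z *m e))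
    - ip e ((Dmx z)^T *m (B^T *m (A *m (B^T *m ev))))).
Proof.
move=> z ev e f g; rewrite closed_loop_verr -/z -/ev -/e /lyap_dot -/g.
have -> : (Dmx z)^T *m (B^T *m v) = g + f.
  by rewrite (closed_loop_relpos p v) mulmxDr.
have -> : (Dmx z)^T *m (B^T *m (- ev - B *m (Dmx z *m e) - A *m (B^T *m ev))) =
    - g - (Dmx z)^T *m (B^T *m (B *m (Dmx z *m e)))
    - (Dmx z)^T *m (B^T *m (A *m (B^T *m ev))).
  by rewrite !mulmxBr !mulmxN.
have gE : ip ev (B *m (Dmx z *m e)) = ip e g by rewrite ip_mulr ip_mulr ipC.
have BDe : ip e ((Dmx z)^T *m (B^T *m (B *m (Dmx z *m e)))) =
    ip (B *m (Dmx z *m e)) (B *m (Dmx z *m e)) by rewrite !ip_mulr !trmxK.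
clearbody g f e ev; rewrite !(ipDl, ipBr, ipDr, ipZl, ipZr, ipNr) gE BDe (ipC f g).
by field.
Qed.

Definition lyap_weight (C : R) : R := (12 * C ^+ 4)^-1.
Definition speed_bound (C : R) : R := lyap_weight C / (8 * C ^+ 6).
Definition decay_rate (C : R) : R := lyap_weight C / (4 * C ^+ 2).

(** Here [x = |e|], [y = |ev|] and [r = |mu|]. The weight satisfies
    [eps * C ^ 4 = 1 / 12], so that the terms in [eps * y ^ 2] use up a quarter of
    the damping [y ^ 2]; the bound on [r] makes every term with a factor [r] a
    fraction of [y ^ 2] or of the damping [eps * x ^ 2 / C ^ 2]. *)
Lemma scalar_decay (C r x y W : R) : 1 <= C -> 0 <= r -> r <= speed_bound C ->
  0 <= x -> 0 <= y ->
  let eps := lyap_weight C in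
  W <= (eps + 1) * (C * r * x * x) - y ^+ 2 + C ^+ 2 * r * y ^+ 2 +
    eps * (2 * (C ^+ 4 * y ^+ 2) + 2 * (C ^+ 3 * r * x * y) +
      (C ^+ 3 * y ^+ 2 + C ^+ 4 * r * x * y) - x ^+ 2 / C ^+ 2 + C ^+ 4 * r * x * y) ->
  W <= - decay_rate C * (x ^+ 2 + y ^+ 2).
Proof.
move=> C1 r0 rs x0 y0 eps; set K := C ^+ 4; pose q := K * r; pose h := eps / C ^+ 2.
have C0 : 0 < C by lra.
have K0 : 0 < K by rewrite exprn_gt0.
have powC i j : (i <= j)%N -> C ^+ i <= C ^+ j by move=> ij; rewrite ler_weXn2l.
have eK : eps * K = 12^-1 by rewrite /eps /lyap_weight -/K; field; rewrite gt_eqF.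
have e0 : 0 < eps by rewrite invr_gt0 mulr_gt0.
have e12 : eps <= 12^-1.
  by rewrite -eK ler_peMr // ?(ltW e0) // (powC 0%N 4%N).
have h0 : 0 < h by rewrite divr_gt0 // exprn_gt0.
have he : h <= 12^-1.
  apply: le_trans e12; rewrite ler_pdivrMr ?exprn_gt0 // ler_peMr ?(ltW e0) //.
  exact: (powC 0%N 2%N).
have q0 : 0 <= q by rewrite mulr_ge0 // ltW.
have qh : q <= h / 8.
  have -> : h / 8 = K * speed_bound C.
    by rewrite /h /K /speed_bound -/eps; field; rewrite gt_eqF.
  by rewrite ler_pM2l.
have rate : decay_rate C = h / 4.
  by rewrite /decay_rate /h -/eps; field; rewrite gt_eqF.
have xy : x * y <= (x ^+ 2 + y ^+ 2) / 2 by have := sqr_ge0 (x - y); lra.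
have low i : (i <= 4)%N -> C ^+ i * r <= q by move=> i4; rewrite ler_wpM2r // powC.
have x20 := sqr_ge0 x; have y20 := sqr_ge0 y.
have xy0 : 0 <= x * y by rewrite mulr_ge0.
have a1 : C * r * x * x <= q * x ^+ 2.
  by rewrite -mulrA -expr2 ler_wpM2r // (low 1%N).
have a2 : C ^+ 2 * r * y ^+ 2 <= q * y ^+ 2 by rewrite ler_wpM2r // low.
have a3 : C ^+ 3 * r * x * y <= q * (x * y).
  by rewrite -(mulrA _ x) ler_wpM2r // low.
have a4 : K * r * x * y = q * (x * y) by rewrite /q -!mulrA.
have a5 : C ^+ 3 * y ^+ 2 <= K * y ^+ 2 by rewrite ler_wpM2r // powC.
have a6 : q * (x * y) <= q * ((x ^+ 2 + y ^+ 2) / 2) by rewrite ler_wpM2l.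
have b1 : (eps + 1) * (C * r * x * x) <= 2 * (q * x ^+ 2).
  apply: ler_pM; rewrite ?mulr_ge0 // ?(ltW C0) //; lra.
have b2 : eps * (2 * (K * y ^+ 2) + 2 * (C ^+ 3 * r * x * y) +
      (C ^+ 3 * y ^+ 2 + K * r * x * y) - x ^+ 2 / C ^+ 2 + K * r * x * y)
    <= eps * (3 * (K * y ^+ 2) + 2 * (q * (x ^+ 2 + y ^+ 2)) - x ^+ 2 / C ^+ 2).
  rewrite ler_pM2l //; lra.
have b3 : eps * (3 * (K * y ^+ 2) + 2 * (q * (x ^+ 2 + y ^+ 2)) - x ^+ 2 / C ^+ 2) =
    3 * (eps * K) * y ^+ 2 + 2 * (eps * (q * (x ^+ 2 + y ^+ 2))) - h * x ^+ 2.
  by rewrite /h; field; rewrite gt_eqF.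
have b4 : eps * (q * (x ^+ 2 + y ^+ 2)) <= 12^-1 * (q * (x ^+ 2 + y ^+ 2)).
  by rewrite ler_wpM2r // mulr_ge0 // addr_ge0.
have qx : q * x ^+ 2 <= h / 8 * x ^+ 2 by rewrite ler_wpM2r.
have qy : q * y ^+ 2 <= h / 8 * y ^+ 2 by rewrite ler_wpM2r.
have hy : h * y ^+ 2 <= 12^-1 * y ^+ 2 by rewrite ler_wpM2r.
have hx : 0 <= h * x ^+ 2 by rewrite mulr_ge0 // ltW.
rewrite eK in b3; rewrite rate => hW; apply: le_trans hW _.
rewrite !(mulrDr q) in b2 b3 b4 *; lra.
Qed.

Lemma lyap_decreases (C : R) (p v : 'cV[R]_(n * m)) : 1 <= C ->
  fnorm (col_mx mu mut) <= speed_bound C ->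
  uniform_bounds G pb C mu mut (relpos G p) ->
  lyap_dot (lyap_weight C) (err zb (relpos G p)) (relpos G p) (verr G mu mut p v)
    (2 *: ((Dmx (relpos G p))^T *m (B^T *m v))) (B^T *m v)
    (control G zb 1 1 mu mut p v - A *m (B^T *m v)) <=
  - decay_rate C * (ip (err zb (relpos G p)) (err zb (relpos G p)) +
                    ip (verr G mu mut p v) (verr G mu mut p v)).
Proof.
move=> C1 rs [bB bz be bc bA bf]; rewrite lyap_dotE.
set z := relpos G p in bz be bc bf *; set ev := verr _ _ _ _ _.
set e := err zb z in be bc bf *; set f := drift _ _ _ _ in bf *; set g := (Dmx z)^T *m (B^T *m ev).
set r := fnorm (col_mx mu mut) in rs bA bf.
rewrite -!sqr_fnorm; have r0 : 0 <= r := fnorm_ge0 _.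
set x := fnorm e in be bc bf *; set y := fnorm ev.
have x0 : 0 <= x := fnorm_ge0 _; have y0 : 0 <= y := fnorm_ge0 _.
have C0 : 0 < C by lra.
have mulb p1 q1 r1 (M : 'M[R]_(p1, q1)) (w : 'M[R]_(q1, r1)) a b :
    fnorm M <= a -> fnorm w <= b -> fnorm (M *m w) <= a * b.
  by move=> Ma wb; apply: le_trans (fnormM _ _) _; rewrite ler_pM ?fnorm_ge0.
have ipb p1 q1 (w w' : 'M[R]_(p1, q1)) a b :
    fnorm w <= a -> fnorm w' <= b -> `|ip w w'| <= a * b.
  by move=> wa wb; apply: le_trans (ler_norm_ip _ _) _; rewrite ler_pM ?fnorm_ge0.
have Btw w a : fnorm w <= a -> fnorm (B^T *m w) <= C * a.
  by apply: mulb; rewrite fnorm_tr.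
have Dzw w a : fnorm w <= a -> fnorm ((Dmx z)^T *m w) <= C * a.
  by apply: mulb; rewrite fnorm_tr fnorm_Dmx.
have Btev : fnorm (B^T *m ev) <= C * y by exact: Btw.
have gy : fnorm g <= C * (C * y) by exact: Dzw.
have ABev : fnorm (A *m (B^T *m ev)) <= C * r * (C * y) by exact: mulb.
have z'b : fnorm (B^T *m v) <= C * y + C * (C * r * C).
  rewrite (closed_loop_relpos p v) -/ev -/z; apply: le_trans (fnormD _ _) _.
  by rewrite lerD //; apply: Btw; exact: mulb.
have t1 : ip e f <= C * r * x * x.
  by apply: le_trans (ler_ip _ _) _; rewrite mulrC ler_wpM2r.
have /ler_normlP[t2 _] : `|ip ev (A *m (B^T *m ev))| <= y * (C * r * (C * y)) by exact: ipb.
have /ler_normlP[_ t3] : `|ip g g| <= C * (C * y) * (C * (C * y)) by exact: ipb.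
have /ler_normlP[_ t4] : `|ip f g| <= C * r * x * (C * (C * y)) by exact: ipb.
have /ler_normlP[_ t5] : `|ip e ((Dmx (B^T *m v))^T *m (B^T *m ev))| <=
    x * ((C * y + C * (C * r * C)) * (C * y)).
  by apply: ipb => //; apply: mulb => //; rewrite fnorm_tr fnorm_Dmx.
have /ler_normlP[t6 _] : `|ip e ((Dmx z)^T *m (B^T *m (A *m (B^T *m ev))))| <=
    x * (C * (C * (C * r * (C * y)))).
  by apply: ipb => //; apply: Dzw; exact: Btw.
have t7 : x ^+ 2 / C ^+ 2 <= fnorm (B *m (Dmx z *m e)) ^+ 2.
  rewrite ler_pdivrMr ?exprn_gt0 // mulrC -exprMn.
  by rewrite ler_pXn2r ?nnegrE // mulr_ge0 ?fnorm_ge0 // ltW.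
have t8 : x * ((C * y + C * (C * r * C)) * (C * y)) <=
    C ^+ 3 * y ^+ 2 + C ^+ 4 * r * x * y.
  have -> : x * ((C * y + C * (C * r * C)) * (C * y)) =
    x * (C ^+ 2 * y ^+ 2) + C ^+ 4 * r * x * y by ring.
  rewrite lerD2r (_ : C ^+ 3 * y ^+ 2 = C * (C ^+ 2 * y ^+ 2)); last by ring.
  by rewrite ler_wpM2r // mulr_ge0 ?sqr_ge0.
rewrite sqr_fnorm -/g; apply: (scalar_decay C1 r0 rs x0 y0).
have e0 : 0 < lyap_weight C by rewrite invr_gt0 mulr_gt0 // exprn_gt0.
have -> : C ^+ 2 * r * y ^+ 2 = y * (C * r * (C * y)) by ring.
have -> : C ^+ 4 * y ^+ 2 = C * (C * y) * (C * (C * y)) by ring.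
have -> : C ^+ 3 * r * x * y = C * r * x * (C * (C * y)) by ring.
have s1 : (lyap_weight C + 1) * ip e f <= (lyap_weight C + 1) * (C * r * x * x).
  by rewrite ler_wpM2l // addr_ge0 // ltW.
rewrite lerD //; first by lra.
rewrite ler_pM2l //.
have -> : C ^+ 4 * r * x * y = x * (C * (C * (C * r * (C * y)))) by ring.
have u : C ^+ 4 * r * x * y = x * (C * (C * (C * r * (C * y)))) by ring.
rewrite u in t8; lra.
Qed.

Lemma lyap_bounds (C : R) e z ev : 1 <= C -> fnorm B <= C -> fnorm z <= C ->
  (ip e e + ip ev ev) / 8 <= lyap (lyap_weight C) e z ev <= ip e e + ip ev ev.
Proof.
move=> C1 bB bz; rewrite /lyap; set eps := lyap_weight C.
have C0 : 0 < C by lra.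
have e0 : 0 < eps by rewrite invr_gt0 mulr_gt0 // exprn_gt0.
have eC : eps * C ^+ 2 <= 12^-1.
  apply: (@le_trans _ _ (eps * C ^+ 4)); first by rewrite ler_pM2l // ler_weXn2l.
  by rewrite /eps /lyap_weight invfM mulfVK // gt_eqF // exprn_gt0.
have e12 : eps <= 12^-1.
  by apply: le_trans eC; rewrite ler_peMr ?(ltW e0) // exprn_ege1.
have : `|ip e ((Dmx z)^T *m (B^T *m ev))| <= C ^+ 2 * (fnorm e * fnorm ev).
  apply: le_trans (ler_norm_ip _ _) _.
  rewrite mulrCA ler_wpM2l ?fnorm_ge0 //; apply: le_trans (fnormM _ _) _.
  rewrite fnorm_tr fnorm_Dmx expr2 -mulrA; apply: ler_pM; rewrite ?fnorm_ge0 //.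
  by apply: le_trans (fnormM _ _) _; rewrite fnorm_tr ler_wpM2r ?fnorm_ge0.
move: (ip e _) => w /ler_normlP[w1 w2].
rewrite -!sqr_fnorm; set x := fnorm e in w1 w2 *; set y := fnorm ev in w1 w2 *.
have xy : x * y <= (x ^+ 2 + y ^+ 2) / 2 by have := sqr_ge0 (x - y); lra.
have x20 := sqr_ge0 x; have y20 := sqr_ge0 y.
have xy0 : 0 <= x * y by rewrite mulr_ge0 ?fnorm_ge0.
have c1 : eps * (C ^+ 2 * (x * y)) <= 12^-1 * (x * y) by rewrite mulrA ler_wpM2r.
have d1 : eps * w <= eps * (C ^+ 2 * (x * y)) by rewrite ler_pM2l.
have d2 : eps * - w <= eps * (C ^+ 2 * (x * y)) by rewrite ler_pM2l.
have ex : eps * x ^+ 2 <= 12^-1 * x ^+ 2 by rewrite ler_wpM2r.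
have ex0 : 0 <= eps * x ^+ 2 by rewrite mulr_ge0 // ltW.
apply/andP; split; lra.
Qed.

End Lyapunov.

(** * Calculus along trajectories *)

Section MatrixDerivative.
Variable R : realType.

(** Entrywise, so that product rules reduce to the scalar ones. *)
Definition mderive p q (f : R -> 'M[R]_(p, q)) (t : R) (f' : 'M[R]_(p, q)) : Prop :=
  forall i j, is_derive t 1 (fun s => f s i j) (f' i j).

Lemma is_derive_mderive p q (f : R -> 'M[R]_(p, q)) (t : R) f' :
  is_derive t 1 f f' -> mderive f t f'.
Proof.
move=> [df <-] i j; have dfij := (derivable_mxP f t 1).1 df i j.
by apply: DeriveDef => //; rewrite derive_mx // mxE.
Qed.

Lemma derive_eqfun (f g : R -> R) (t df dg : R) :
  is_derive t 1 f df -> f =1 g -> df = dg -> is_derive t 1 g dg.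
Proof. by move=> h /funext <- <-. Qed.

Lemma mderive_cst p q (a : 'M[R]_(p, q)) (t : R) : mderive (fun=> a) t 0.
Proof. by move=> i j; rewrite mxE; exact: is_derive_cst. Qed.

Lemma mderiveD p q (f g : R -> 'M[R]_(p, q)) (t : R) f' g' :
  mderive f t f' -> mderive g t g' -> mderive (fun s => f s + g s) t (f' + g').
Proof.
move=> df dg i j; apply: derive_eqfun (is_deriveD (df i j) (dg i j)) _ _.
  by move=> s; rewrite mxE.
by rewrite mxE.
Qed.

Lemma mderiveN p q (f : R -> 'M[R]_(p, q)) (t : R) f' :
  mderive f t f' -> mderive (fun s => - f s) t (- f').
Proof.
move=> df i j; apply: derive_eqfun (is_deriveN (df i j)) _ _.
  by move=> s; rewrite mxE.
by rewrite mxE.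
Qed.

Lemma mderiveM p q r (f : R -> 'M[R]_(p, q)) (g : R -> 'M[R]_(q, r)) (t : R) f' g' :
  mderive f t f' -> mderive g t g' ->
  mderive (fun s => f s *m g s) t (f' *m g t + f t *m g').
Proof.
move=> df dg i j.
have h k := is_deriveM (df i k) (dg k j).
apply: derive_eqfun (is_derive_sum h) _ _.
  by move=> s; rewrite fct_sumE mxE.
rewrite !mxE -big_split /=; apply: eq_bigr => k _.
by rewrite /GRing.scale /= addrC [g t k j * _]mulrC.
Qed.

Lemma mderive_tr p q (f : R -> 'M[R]_(p, q)) (t : R) f' :
  mderive f t f' -> mderive (fun s => (f s)^T) t f'^T.
Proof.
move=> df i j; apply: derive_eqfun (df j i) _ _ => [s|]; by rewrite mxE.
Qed.

Lemma mderive_Dmx m k (f : R -> 'cV[R]_(k * m)) (t : R) f' :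
  mderive f t f' -> mderive (fun s => Dmx (f s)) t (Dmx f').
Proof.
move=> df r j; have [rj|rj] := eqVneq (mxtens_unindex r).1 j.
  by apply: derive_eqfun (df r 0) _ _ => [s|]; rewrite mxE rj eqxx.
apply: derive_eqfun (is_derive_cst 0 t 1) _ _ => [s|]; by rewrite mxE (negbTE rj).
Qed.

Lemma mderive_mull p q r (M : 'M[R]_(p, q)) (f : R -> 'M[R]_(q, r)) (t : R) f' :
  mderive f t f' -> mderive (fun s => M *m f s) t (M *m f').
Proof.
by move=> df; have := mderiveM (mderive_cst M t) df; rewrite mul0mx add0r.
Qed.

Lemma derive_ip k (f g : R -> 'cV[R]_k) (t : R) f' g' :
  mderive f t f' -> mderive g t g' ->
  is_derive t 1 (fun s => ip (f s) (g s)) (ip f' (g t) + ip (f t) g').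
Proof.
move=> df dg; apply: derive_eqfun (mderiveM (mderive_tr df) dg 0 0) _ _ => [s|].
  by rewrite /ip trace_mx11.
by rewrite mxE /ip !trace_mx11.
Qed.

Lemma eq_mderive p q (f : R -> 'M[R]_(p, q)) (t : R) f' g' :
  mderive f t f' -> f' = g' -> mderive f t g'.
Proof. by move=> ? <-. Qed.

(** Induction on a real interval: a property that passes from [0, t[ to a
    neighbourhood of [t] holds throughout, by a supremum argument. *)
Lemma real_induction (P : R -> Prop) (b : R) :
  (forall t, 0 <= t <= b -> (forall s, 0 <= s -> s < t -> P s) ->
    exists2 e, 0 < e & forall s, 0 <= s <= b -> s < t + e -> P s) ->
  forall t, 0 <= t <= b -> P t.
Proof.
move=> step t /andP[t0 tb]; have b0 := le_trans t0 tb.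
pose S := [set s : R | 0 <= s <= b /\ forall u, 0 <= u <= s -> P u]%classic.
have S0 : S 0.
  split; first by rewrite lexx.
  move=> u u0; have -> : u = 0 by apply/le_anti; rewrite andbC.
  have [|s s0 s1|e e0] := step 0; first by rewrite lexx.
    by have := le_lt_trans s0 s1; rewrite ltxx.
  by apply; rewrite ?lexx // add0r.
have hS : has_sup S by split; [exists 0|exists b => s [/andP[]]].
have u0 : 0 <= sup S by exact: (sup_upper_bound hS).
have ub : sup S <= b by apply: ge_sup; [exists 0|move=> s [/andP[]]].
have [|s s0 su|e e0 eP] := step (sup S); first by rewrite u0.
  have [|w [_ wP] sw] := @sup_adherent _ S (sup S - s) _ hS; first by rewrite subr_gt0.
  by apply: wP; rewrite s0 ltW //; lra.
have [be|be] := ltP b (sup S + e); first by apply: eP; rewrite ?t0 //; exact: le_lt_trans be.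
have : S (sup S + e / 2).
  split; first by apply/andP; split; lra.
  move=> u /andP[uu0 ue]; apply: eP; last by lra.
  by rewrite uu0 /=; lra.
by move/(sup_upper_bound hS); lra.
Qed.

End MatrixDerivative.

Section Trajectories.
Local Open Scope classical_set_scope.
Variables (R : realType) (n E m : nat) (G : graph n E) (pb : 'cV[R]_(n * m)).
Variables (mu mut : 'cV[R]_E) (T : \bar R) (p v : R -> 'cV[R]_(n * m)).
Local Notation zb := (relpos G pb).
Local Notation B := (bar m (incidence R G)).
Local Notation A := (bar m (Av G mu mut)).
Hypothesis sol : solution G zb 1 1 mu mut T p v.

Definition energy (eps : R) (t : R) : R :=
  lyap G eps (err zb (relpos G (p t))) (relpos G (p t)) (verr G mu mut (p t) (v t)).

Lemma derive_energy eps t : 0 < t -> (t%:E < T)%E ->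
  is_derive t 1 (energy eps)
    (lyap_dot G eps (err zb (relpos G (p t))) (relpos G (p t)) (verr G mu mut (p t) (v t))
      (2 *: ((Dmx (relpos G (p t)))^T *m (B^T *m v t))) (B^T *m v t)
      (control G zb 1 1 mu mut (p t) (v t) - A *m (B^T *m v t))).
Proof.
move=> t0 tT; have [_ _ /(_ t t0 tT)[/is_derive_mderive dp /is_derive_mderive dv]] := sol.
have dz : mderive (fun s => relpos G (p s)) t (B^T *m v t) by exact: mderive_mull.
have de : mderive (fun s => err zb (relpos G (p s))) t
    (2 *: ((Dmx (relpos G (p t)))^T *m (B^T *m v t))).
  rewrite (_ : (fun s => _) = fun s => (Dmx (relpos G (p s)))^T *m relpos G (p s) +
      - ((Dmx zb)^T *m zb)); last by apply/funext => s; rewrite errE.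
  apply: eq_mderive (mderiveD (mderiveM (mderive_tr (mderive_Dmx dz)) dz) (mderive_cst _ _)) _.
  by rewrite addr0 DmxT_mulC scaler_nat mulr2n.
have dev : mderive (fun s => verr G mu mut (p s) (v s)) t
    (control G zb 1 1 mu mut (p t) (v t) - A *m (B^T *m v t)).
  by apply: mderiveD => //; apply: mderiveN; exact: mderive_mull.
have dB := mderive_mull B^T dev.
have dg := mderiveM (mderive_tr (mderive_Dmx dz)) dB.
have d1 := is_deriveZ ((eps + 1) / 4) (derive_ip de de).
have d2 := is_deriveZ (1 / 2) (derive_ip dev dev).
have d3 := is_deriveZ eps (derive_ip de dg).
apply: derive_eqfun (is_deriveD (is_deriveD d1 d2) d3) _ _ => [s|] //.
rewrite /lyap_dot /GRing.scale /= ipDr.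
rewrite [ip (2 *: _) (err _ _)]ipC [ip (control _ _ _ _ _ _ _ _ - _) (verr _ _ _ _ _)]ipC.
by field.
Qed.

Section Limits.
Context {F : set_system R} {FF : Filter F}.

Lemma cvg_relpos t : p @ F --> p t -> relpos G (p s) @[s --> F] --> relpos G (p t).
Proof. by move=> pt; apply: cvg_mulmx => //; exact: cvg_cst. Qed.

Lemma cvg_energy eps t : p @ F --> p t -> v @ F --> v t -> energy eps @ F --> energy eps t.
Proof.
move=> pt vt; have zt := cvg_relpos pt.
have et : err zb (relpos G (p s)) @[s --> F] --> err zb (relpos G (p t)).
  under eq_cvg do rewrite errE.
  rewrite errE; apply: cvgB; last exact: cvg_cst.
  by apply: cvg_mulmx => //; apply: cvg_trmx; exact: cvg_Dmx.
have evt : verr G mu mut (p s) (v s) @[s --> F] --> verr G mu mut (p t) (v t).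
  by apply: cvgB => //; apply: cvg_mulmx => //; exact: cvg_cst.
apply: cvgD; first apply: cvgD.
- by apply: cvgM; [exact: cvg_cst|exact: cvg_ip].
- by apply: cvgM; [exact: cvg_cst|exact: cvg_ip].
apply: cvgM; first exact: cvg_cst.
apply: cvg_ip => //.
apply: cvg_mulmx; first by apply: cvg_trmx; exact: cvg_Dmx.
by apply: cvg_mulmx => //; exact: cvg_cst.
Qed.

End Limits.

Lemma within_solution t1 : (t1%:E < T)%E ->
  forall t, 0 <= t <= t1 ->
  p @ within `[0, t1] (nbhs t) --> p t /\ v @ within `[0, t1] (nbhs t) --> v t.
Proof.
move=> t1T t tt1; have [cp cv _] := sol.
have sub : `[0, t1] `<=` [set s : R | 0 <= s /\ (s%:E < T)%E].
  move=> s /=; rewrite in_itv /= => /andP[s0 st1]; split => //.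
  by apply: le_lt_trans t1T; rewrite lee_fin.
have tin : `[0, t1] t by rewrite /= in_itv.
by split; apply: (subspace_continuousP _ _).1 tin; apply: continuous_subspaceW sub _.
Qed.

(** Along a trajectory on which the estimates hold, [energy * exp (rate * t)] is
    nonincreasing. *)
Lemma energy_decay (C t1 : R) : 1 <= C -> fnorm (col_mx mu mut) <= speed_bound C ->
  (t1%:E < T)%E -> 0 <= t1 ->
  (forall s, 0 <= s <= t1 -> uniform_bounds G pb C mu mut (relpos G (p s))) ->
  energy (lyap_weight C) t1 <= energy (lyap_weight C) 0 * expR (- decay_rate C * t1).
Proof.
move=> C1 rs t1T t10 ub; set eps := lyap_weight C; set k := decay_rate C.
have k0 : 0 < k.
  have C0 : 0 < C by lra.
  by rewrite divr_gt0 ?invr_gt0 ?mulr_gt0 // exprn_gt0.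
pose g s := energy eps s * expR (k * s).
pose g' s := energy eps s * (expR (k * s) * k) + expR (k * s) *
    lyap_dot G eps (err zb (relpos G (p s))) (relpos G (p s)) (verr G mu mut (p s) (v s))
      (2 *: ((Dmx (relpos G (p s)))^T *m (B^T *m v s))) (B^T *m v s)
      (control G zb 1 1 mu mut (p s) (v s) - A *m (B^T *m v s)).
have dg s : s \in `]0, t1[%R -> is_derive s 1 g (g' s).
  rewrite in_itv /= => /andP[s0 st1].
  have sT : (s%:E < T)%E by apply: lt_trans t1T; rewrite lte_fin.
  have dk : is_derive s 1 (fun u => k * u) k.
    apply: derive_eqfun (is_deriveZ k (is_derive_id s 1)) _ _ => //.
    by rewrite /GRing.scale /= mulr1.
  have dexp : is_derive s 1 (fun u => expR (k * u)) (expR (k * s) * k).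
    by apply: (@is_derive1_comp _ expR (fun u => k * u)) dk.
  exact: derive_eqfun (is_deriveM (derive_energy eps s0 sT) dexp) _ _.
have g'0 s : s \in `]0, t1[%R -> g' s <= 0.
  rewrite in_itv /= => /andP[s0 st1].
  have us := ub s; rewrite (ltW s0) (ltW st1) in us.
  have dec := lyap_decreases (v s) C1 rs (us isT).
  have [bB bz _ _ _ _] := us isT.
  have /andP[_ up] := lyap_bounds (err zb (relpos G (p s))) (verr G mu mut (p s) (v s)) C1 bB bz.
  rewrite /g' mulrCA -mulrDr pmulr_rle0 ?expR_gt0 //.
  apply: le_trans (_ : energy eps s * k + - k *
    (ip (err zb (relpos G (p s))) (err zb (relpos G (p s))) +
     ip (verr G mu mut (p s) (v s)) (verr G mu mut (p s) (v s))) <= _).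
    by rewrite lerD2l.
  by rewrite mulNr subr_le0 mulrC ler_pM2l.
have cg : {within `[0, t1], continuous g}.
  have /subspace_continuousP ce : {within `[0, t1], continuous (fun u : R => expR (k * u))}.
    apply: continuous_subspaceT => u.
    by apply: continuous_comp; [exact: mulrl_continuous|exact: continuous_expR].
  apply/subspace_continuousP => s st1; apply: cvgM; last exact: ce.
  move: st1; rewrite /= in_itv /= => /(within_solution t1T)[ps vs].
  exact: cvg_energy.
have dle s : s \in `]0, t1[%R -> g^`() s <= 0.
  by move=> sI; have ds := dg s sI; rewrite derive1E derive_val; exact: g'0.
have i0 : 0 \in `[0, t1]%R by rewrite in_itv /= lexx.
have i1 : t1 \in `[0, t1]%R by rewrite in_itv /= lexx andbT.
have := ler0_derive1_le_cc (fun s sI => @ex_derive _ _ _ _ _ _ _ (dg s sI)) dle cg i1 i0 t10.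
rewrite /g mulr0 expR0 mulr1 mulNr expRN => le.
by rewrite ler_pdivlMr ?expR_gt0.
Qed.

End Trajectories.

(** * Exponential stability *)

Section Stability.
Local Open Scope classical_set_scope.
Variables (R : realType) (n E m : nat) (G : graph n E) (pb : 'cV[R]_(n * m)).
Local Notation zb := (relpos G pb).
(** [d0] is a radius within which the estimates hold, and an error of at most
    [sqrt rho] confines configurations within [delta] to the radius [d0 / 2]. *)
Variables (d0 delta C rho : R).
Hypotheses (d00 : 0 < d0) (d0delta : d0 <= delta) (C1 : 1 <= C) (rho0 : 0 < rho).
Hypothesis est : forall p d, d <= d0 -> near_shape zb d (relpos G p) ->
  (exists Q : 'M[R]_m, [/\ SO m Q, fnorm (relpos G p - rotmx E Q *m zb) <= d &
    fnorm (relpos G p - rotmx E Q *m zb) <= C * fnorm (err zb (relpos G p))]) /\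
  forall mu mut, designed G zb mu mut -> uniform_bounds G pb C mu mut (relpos G p).
Hypothesis conf : forall p, near_shape zb delta (relpos G p) ->
  fnorm (err zb (relpos G p)) ^+ 2 <= rho -> near_shape zb (d0 / 2) (relpos G p).
Variables (mu mut : 'cV[R]_E).
Hypotheses (des : designed G zb mu mut) (slow : fnorm (col_mx mu mut) <= speed_bound C).

Let sqerr (p v : 'cV[R]_(n * m)) : R :=
  ip (err zb (relpos G p)) (err zb (relpos G p)) +
  ip (verr G mu mut p v) (verr G mu mut p v).

Lemma weight_gt0 : 0 < lyap_weight C.
Proof.
have C0 : 0 < C := lt_le_trans ltr01 C1.
by rewrite invr_gt0 mulr_gt0 // exprn_gt0.
Qed.

Lemma rate_gt0 : 0 < decay_rate C.
Proof.
have C0 : 0 < C := lt_le_trans ltr01 C1.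
by rewrite divr_gt0 ?weight_gt0 // mulr_gt0 // exprn_gt0.
Qed.

Lemma Qset_sqerr r (p v : 'cV[R]_(n * m)) :
  Qset 1 1 r (lyap_weight C) (err zb (relpos G p)) (verr G mu mut p v) ->
  sqerr p v <= 4 * r.
Proof.
rewrite /Qset /sqerr !enormE !sqr_fnorm.
have e0 := ip_ge0 (err zb (relpos G p)); have ev0 := ip_ge0 (verr G mu mut p v).
have : 0 <= lyap_weight C * ip (err zb (relpos G p)) (err zb (relpos G p)).
  by rewrite mulr_ge0 // ltW // weight_gt0.
by lra.
Qed.

Section OneTrajectory.
Variables (T : \bar R) (p v : R -> 'cV[R]_(n * m)).
Hypothesis sol : solution G zb 1 1 mu mut T p v.
Hypothesis near0 : near_shape zb delta (relpos G (p 0)).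
Hypothesis small0 : sqerr (p 0) (v 0) <= rho / 8.

(** The factor 8 is the ratio of the two bounds of [lyap_bounds]. *)
Lemma decay_while_near (t : R) : 0 <= t -> (t%:E < T)%E ->
  (forall s, 0 <= s <= t -> near_shape zb d0 (relpos G (p s))) ->
  sqerr (p t) (v t) <= 8 * sqerr (p 0) (v 0) * expR (- decay_rate C * t).
Proof.
move=> t0 tT near; have ub s (st : 0 <= s <= t) := (est (lexx _) (near s st)).2 _ _ des.
have dec := energy_decay sol C1 slow tT t0 ub.
have t00 : 0 <= (0 : R) <= t by rewrite lexx.
have tt : 0 <= t <= t by rewrite t0 lexx.
have [bB bz0 _ _ _ _] := ub 0 t00; have [_ bzt _ _ _ _] := ub t tt.
have /andP[_ up] :=
  lyap_bounds (err zb (relpos G (p 0))) (verr G mu mut (p 0) (v 0)) C1 bB bz0.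
have /andP[low _] :=
  lyap_bounds (err zb (relpos G (p t))) (verr G mu mut (p t) (v t)) C1 bB bzt.
have : energy G pb mu mut p v (lyap_weight C) 0 * expR (- decay_rate C * t) <=
    sqerr (p 0) (v 0) * expR (- decay_rate C * t).
  by rewrite ler_wpM2r ?expR_ge0.
move: low dec; rewrite /energy /sqerr; lra.
Qed.

(** The trajectory cannot leave the neighbourhood: as long as it is within [d0]
    the error decays, and then it is even within [d0 / 2]. *)
Lemma trajectory_near (t : R) : 0 <= t -> (t%:E < T)%E ->
  near_shape zb (d0 / 2) (relpos G (p t)).
Proof.
move=> t0 tT; have d00' := d00; have rho0' := rho0; have small0' := small0.
have sq0 s : 0 <= ip (verr G mu mut (p s) (v s)) (verr G mu mut (p s) (v s)) := ip_ge0 _.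
apply: (@real_induction _ (fun s => near_shape zb (d0 / 2) (relpos G (p s))) t);
  last by rewrite t0 lexx.
move=> u /andP[u0 ut] prev.
have init : near_shape zb (d0 / 2) (relpos G (p 0)).
  apply: conf => //; rewrite sqr_fnorm; have := sq0 0; move: small0'; rewrite /sqerr; lra.
have u0t : 0 <= u <= t by rewrite u0.
have [pu _] := within_solution sol tT u0t.
have zu : fnorm (relpos G (p s) - relpos G (p u)) @[s --> within `[0, t] (nbhs u)]
    --> (0 : R).
  rewrite -[X in _ --> X](fnorm0 R (E * m) 1) -[X in _ --> fnorm X](subrr (relpos G (p u))).
  by apply: cvg_fnorm; apply: cvgB; [exact: cvg_relpos|exact: cvg_cst].
have /cvgrPdist_lt /(_ (d0 / 4)) := zu.
move=> /(_ _)[|e /= e0 close]; first by lra.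
have {}close s : 0 <= s <= t -> `|u - s| < e ->
    fnorm (relpos G (p s) - relpos G (p u)) < d0 / 4.
  move=> st us; have := close s us; rewrite /= in_itv /= => /(_ st).
  by rewrite sub0r normrN ger0_norm // fnorm_ge0.
exists e => // s /andP[s0 st] sue.
have ball w : 0 <= w <= t -> w < u + e -> near_shape zb d0 (relpos G (p w)).
  move=> /andP[w0 wt] wue; have [wu|uw] := ltP w u.
    by apply: near_shape_weaken (prev w w0 wu); lra.
  (* A time close to [u] at which closeness is known; it is [0] when [u = 0]. *)
  pose x := Num.max 0 (u - e / 2).
  have x0 : 0 <= x by rewrite /x le_max lexx.
  have xu : x <= u by rewrite /x ge_max u0 /=; lra.
  have ux : `|u - x| < e.
    rewrite ger0_norm ?subr_ge0 //.
    have : u - e / 2 <= x by rewrite /x le_max lexx orbT.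
    lra.
  have near_x : near_shape zb (d0 / 2) (relpos G (p x)).
    have [xlt|xge] := ltP x u; first exact: prev.
    have ux0 : u = 0.
      have : x = u by apply/le_anti; rewrite xu.
      by rewrite /x; case: leP => //; lra.
    by have -> : x = 0 by apply/le_anti; rewrite x0 -{1}ux0 xu.
  have -> : d0 = d0 / 2 + d0 / 2 by field.
  apply: near_shape_perturb near_x _.
  rewrite -(subrKA (relpos G (p u))); apply: le_trans (fnormD _ _) _.
  rewrite [fnorm (relpos G (p u) - _)]fnormBC.
  have cw : fnorm (relpos G (p w) - relpos G (p u)) < d0 / 4.
    by apply: close; [rewrite w0|rewrite ler0_norm ?subr_le0 //; lra].
  have cx : fnorm (relpos G (p x) - relpos G (p u)) < d0 / 4.
    by apply: close => //; rewrite x0 (le_trans xu).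
  lra.
have sT : (s%:E < T)%E by apply: le_lt_trans tT; rewrite lee_fin.
have dec := decay_while_near s0 sT.
apply: conf.
  by apply: near_shape_weaken d0delta _; apply: ball; rewrite ?s0.
rewrite sqr_fnorm; have := sq0 s.
have : sqerr (p s) (v s) <= 8 * sqerr (p 0) (v 0) * expR (- decay_rate C * s).
  apply: dec => w /andP[w0 ws]; apply: ball; first by rewrite w0 (le_trans ws).
  exact: le_lt_trans ws sue.
have : 8 * sqerr (p 0) (v 0) * expR (- decay_rate C * s) <= 8 * sqerr (p 0) (v 0).
  rewrite ler_piMr ?mulr_ge0 ?addr_ge0 ?ip_ge0 // expR_le1 mulNr oppr_le0.
  by rewrite mulr_ge0 // ltW // rate_gt0.
rewrite /sqerr in small0' *; lra.
Qed.

Lemma trajectory_decay (t : R) : 0 <= t -> (t%:E < T)%E ->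
  enorm (col_mx (err zb (relpos G (p t))) (verr G mu mut (p t) (v t))) <=
  3 * enorm (col_mx (err zb (relpos G (p 0))) (verr G mu mut (p 0) (v 0))) *
    expR (- (decay_rate C / 2) * t).
Proof.
move=> t0 tT; rewrite !enormE -(@ler_pXn2r _ 2) ?nnegrE ?mulr_ge0 ?fnorm_ge0 ?expR_ge0 //.
rewrite !exprMn !fnorm_col_mx !sqr_fnorm -expRM_natl.
have -> : 2%:R * (- (decay_rate C / 2) * t) = - decay_rate C * t by field.
have := @decay_while_near t t0 tT; rewrite /sqerr => dec; have d00' := d00.
apply: le_trans (dec _) _ => [s /andP[s0 st]|].
  apply: near_shape_weaken (trajectory_near s0 _); first by lra.
  by apply: le_lt_trans tT; rewrite lee_fin.
rewrite ler_wpM2r ?expR_ge0 // ler_wpM2r ?addr_ge0 ?ip_ge0 //.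
by rewrite expr2; lra.
Qed.

End OneTrajectory.

Lemma stable : exp_stable_in G zb 1 1 mu mut delta (rho / 32) (lyap_weight C).
Proof.
exists 3, (decay_rate C / 2); split=> //; first by rewrite divr_gt0 // rate_gt0.
move=> T p v T0 sol near0 /Qset_sqerr Q0 t t0 tT.
have small0 : sqerr (p 0) (v 0) <= rho / 8 by lra.
split; last exact: (trajectory_decay sol near0 small0).
apply: near_shape_weaken (trajectory_near sol near0 small0 t0 tT).
by have := d00; have := d0delta; lra.
Qed.

(** The limit motion on the shape consists of points whose distance to the
    configuration is bounded by the decaying error. *)
Lemma steady : steady_state G zb 1 1 mu mut delta (rho / 32) (lyap_weight C).
Proof.
move=> p v sol near0 /Qset_sqerr Q0.
have small0 : sqerr (p 0) (v 0) <= rho / 8 by lra.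
have near t (t0 : 0 <= t) := trajectory_near sol near0 small0 t0 (ltry t).
have dec t (t0 : 0 <= t) := trajectory_decay sol near0 small0 t0 (ltry t).
have /choice[Q QP] (t : R) : exists Q : 'M[R]_m, 0 <= t -> SO m Q /\
    fnorm (relpos G (p t) - rotmx E Q *m zb) <= C * fnorm (err zb (relpos G (p t))).
  have [t0|t0] := leP 0 t; last by exists 1%:M.
  have [|[Q [SQ _ Qe]] _] := est _ (near t t0); first by have := d00; lra.
  by exists Q.
pose N := 3 * enorm (col_mx (err zb (relpos G (p 0))) (verr G mu mut (p 0) (v 0))).
pose a := fnorm (bar m (Av G mu mut)).
have [e_le ev_le] : (forall t, 0 <= t ->
    fnorm (err zb (relpos G (p t))) <= N * expR (- (decay_rate C / 2) * t)) /\
    (forall t, 0 <= t ->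
    fnorm (verr G mu mut (p t) (v t)) <= N * expR (- (decay_rate C / 2) * t)).
  split=> t t0; apply: le_trans (dec t t0); rewrite enormE;
    rewrite -(@ler_pXn2r _ 2) ?nnegrE ?fnorm_ge0 // fnorm_col_mx.
    by rewrite lerDl sqr_ge0.
  by rewrite lerDr sqr_ge0.
have lim0 (f : R -> R) (c : R) : (forall t, 0 <= t ->
    0 <= f t <= c * expR (- (decay_rate C / 2) * t)) -> f t @[t --> +oo] --> (0 : R).
  move=> fc.
  apply: (@squeeze_cvgr _ _ _ _ (fun=> 0) (fun t => c * expR (- (decay_rate C / 2) * t))).
  - by near=> t; apply: fc; near: t; exact: nbhs_pinfty_ge.
  - exact: cvg_cst.
  have k0 : 0 < decay_rate C / 2 by rewrite divr_gt0 // rate_gt0.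
  have scaled : decay_rate C / 2 * t @[t --> +oo] --> +oo.
    by apply: (gt0_cvgMry k0); exact: cvg_id.
  have decay : expR (- (decay_rate C / 2) * t) @[t --> +oo] --> (0 : R).
    rewrite (_ : (fun t => _) = (fun x => expR (- x)) \o *%R (decay_rate C / 2)).
      exact: cvg_comp scaled (@cvgr_expR R).
    by apply/funext => t; rewrite /= mulNr.
  by rewrite -[X in _ --> X](mulr0 c); apply: cvgM; [exact: cvg_cst|].
exists (fun t => rotmx E (Q t) *m zb); split.
- by move=> t /QP[SQ _]; exists (Q t).
- apply: (lim0 _ (C * N)) => t t0; rewrite enormE fnorm_ge0 /=.
  have [_ le] := QP t t0; apply: le_trans le _; rewrite -mulrA ler_wpM2l ?(le_trans ler01 C1) //.
  exact: e_le.
apply: (lim0 _ (N + a * (C * N))) => t t0; rewrite enormE fnorm_ge0 /=.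
have -> : v t - bar m (Av G mu mut) *m (rotmx E (Q t) *m zb) =
    verr G mu mut (p t) (v t) +
    bar m (Av G mu mut) *m (relpos G (p t) - rotmx E (Q t) *m zb).
  by rewrite /verr mulmxBr addrA subrK.
apply: le_trans (fnormD _ _) _; rewrite mulrDl lerD ?ev_le //.
apply: le_trans (fnormM _ _) _; rewrite -(mulrA a) -(mulrA C) ler_wpM2l ?fnorm_ge0 //.
have [_ le] := QP t t0; apply: le_trans le _; rewrite ler_wpM2l ?(le_trans ler01 C1) //.
exact: e_le.
Unshelve. all: by end_near. Qed.

End Stability.

Unset Implicit Arguments.

Theorem theoremV1 (R : realType) (n E m : nat) (hn : (2 <= n)%N)
    (hm : m = 2%N \/ m = 3%N) (G : graph n E)
    (pb : 'cV[R]_(n * m)) (hrigid : inf_min_rigid G pb)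
    (zb : 'cV[R]_(E * m)) (hzb : zb = relpos G pb) :
  (exists2 delta : R, 0 < delta & isolating G zb delta) /\
  forall delta : R, 0 < delta -> isolating G zb delta ->
    exists rho rho_mu eps c1 c2 : R,
      [/\ 0 < rho, 0 < rho_mu, 0 < eps, 0 < c1 & 0 < c2] /\
      forall mu mut : 'cV[R]_E,
        designed G zb mu mut -> enorm (col_mx mu mut) <= rho_mu ->
        exp_stable_in G zb c1 c2 mu mut delta rho eps /\
        steady_state G zb c1 c2 mu mut delta rho eps.
Proof.
rewrite hzb; have [d [C [d0 C1 est]]] := uniform_estimates hn hrigid.
split.
  exists d => //; apply: (isolating_local (C := C)) => p nd.
  by have [] := est p d (lexx _) nd.
move=> delta delta0 iso; pose d' := Num.min d delta.
have d'0 : 0 < d' by rewrite lt_min d0.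
have d'2 : 0 < d' / 2 by rewrite divr_gt0.
have [rho rho0 conf] := confinement iso d'2.
have d'd : d' <= d by rewrite /d' ge_min lexx.
have d'delta : d' <= delta by rewrite /d' ge_min lexx orbT.
have est' p x (xd : x <= d') := est p x (le_trans xd d'd).
have C0 : 0 < C := lt_le_trans ltr01 C1.
exists (rho / 32), (speed_bound C), (lyap_weight C), 1, 1; split.
  have w0 := weight_gt0 C1.
  by split; rewrite ?divr_gt0 // mulr_gt0 // exprn_gt0.
move=> mu mut des; rewrite enormE => slow; split.
  exact: (stable d'0 d'delta C1 rho0 est' conf des slow).
exact: (steady d'0 d'delta C1 rho0 est' conf des slow).
Qed.
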